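(* Suppose $\Lambda$ is a row-finite $k$-graph without sources. Then the space $\operatorname{Spec}^{\mathrm{gr}}(\operatorname{KP}(\Lambda))$ is connected if and only if $T_\Lambda$ is indecomposable.
   Context: $k\ge1$ is an integer, $\mathbb N\ni0$. A $k$-graph is a countable small category $\Lambda$ with a functor $d:\Lambda\to\mathbb N^k$ such that whenever $d(\lambda)=\mathbf m+\mathbf n$ there are unique $\alpha,\beta$ with $d(\alpha)=\mathbf m$, $d(\beta)=\mathbf n$, $\lambda=\alpha\beta$. Objects are identified with $\Lambda^0=d^{-1}(0)$; $r,s$ denote codomain and domain; $v\Lambda^{\mathbf n}=\{\lambda: d(\lambda)=\mathbf n,\ r(\lambda)=v\}$. $\Lambda$ is row-finite if every $v\Lambda^{\mathbf n}$ is finite, and without sources if every $v\Lambda^{\mathbf n}$ is nonempty. The talented monoid $T_\Lambda$ is the commutative monoid generated by $v(\mathbf n)$ ($v\in\Lambda^0$, $\mathbf n\in\mathbb Z^k$) subject to $v(\mathbf n)=\sum_{\alpha\in v\Lambda^{\mathbf m}}s(\alpha)(\mathbf n+\mathbf m)$ for $v\in\Lambda^0,\mathbf n\in\mathbb Z^k,\mathbf m\in\mathbb N^k$, with $\mathbb Z^k$ acting by ${}^{\mathbf q}v(\mathbf n)=v(\mathbf n+\mathbf q)$. $x\le y$ iff $y=x+z$ for some $z$. A $\mathbb Z^k$-order ideal is a submonoid that is a down-set for $\le$ and closed under $\mathbb Z^k$. $T_\Lambda$ is decomposable if there are proper $\mathbb Z^k$-order ideals $J_1,J_2$ with $J_1\cap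 J_2=\{0\}$ such that the $\mathbb Z^k$-order ideal generated by $J_1\cup J_2$ is $T_\Lambda$; otherwise it is indecomposable. $\operatorname{KP}(\Lambda)$ is the universal associative algebra over a fixed arbitrary field generated by $p_v$ ($v\in\Lambda^0$), $s_\lambda,s_{\lambda^*}$ ($\lambda\in\Lambda\setminus\Lambda^0$) subject to: $p_up_v=\delta_{u,v}p_u$; $s_\lambda s_\mu=s_{\lambda\mu}$, $s_{\mu^*}s_{\lambda^*}=s_{(\lambda\mu)^*}$ when $s(\lambda)=r(\mu)$; $p_{r(\lambda)}s_\lambda=s_\lambda=s_\lambda p_{s(\lambda)}$, $p_{s(\lambda)}s_{\lambda^*}=s_{\lambda^*}=s_{\lambda^*}p_{r(\lambda)}$; $s_{\lambda^*}s_\mu=\delta_{\lambda,\mu}p_{s(\lambda)}$ when $d(\lambda)=d(\mu)$; $p_v=\sum_{\lambda\in v\Lambda^{\mathbf n}}s_\lambda s_{\lambda^*}$ for $\mathbf n\ne0$. It is $\mathbb Z^k$-graded with $p_v$, $s_\lambda$, $s_{\lambda^*}$ of degrees $0$, $d(\lambda)$, $-d(\lambda)$. A graded ideal $I$ satisfies $I=\bigoplus_{\mathbf n}(I\cap R_{\mathbf n})$. A proper graded ideal $P$ is graded prime if $IJ\subseteq P$ implies $I\subseteq P$ or $J\subseteq P$ for graded ideals $I,J$. $\operatorname{Spec}^{\mathrm{gr}}(R)$ is the set of graded prime ideals with closed sets $V^{\mathrm{gr}}(I)=\{P:I\subseteq P\}$, $I$ a graded ideal. *)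

(* Defs.v *)
From HB Require Import structures.
From mathcomp Require Import all_boot all_order all_algebra finmap.
From mathcomp Require Import boolp classical_sets cardinality.
From mathcomp Require Import topology_structure connected.

Set Implicit Arguments.
Unset Strict Implicit.
Unset Printing Implicit Defensive.

Import GRing.Theory.

Local Open Scope classical_set_scope.
Local Open Scope ring_scope.
Local Open Scope quotient_scope.

(* [mcomp a b] is the composite of the category, written ab, when
   [src a = rng b]; its value on other pairs is arbitrary and is never used. *)
Record kgraph (k : nat) := KGraph {
  vert : countType;
  mor : countType;
  rng : mor -> vert;
  src : mor -> vert;
  idm : vert -> mor;
  mcomp : mor -> mor -> mor;
  rng_idm : forall v, rng (idm v) = v;
  src_idm : forall v, src (idm v) = v;
  rng_comp : forall a b, src a = rng b -> rng (mcomp a b) = rng a;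
  src_comp : forall a b, src a = rng b -> src (mcomp a b) = src b;
  comp_idl : forall a, mcomp (idm (rng a)) a = a;
  comp_idr : forall a, mcomp a (idm (src a)) = a;
  compA : forall a b c, src a = rng b -> src b = rng c ->
    mcomp a (mcomp b c) = mcomp (mcomp a b) c;
  deg : mor -> 'rV[nat]_k;
  deg_idm : forall v, deg (idm v) = 0;
  deg_comp : forall a b, src a = rng b -> deg (mcomp a b) = deg a + deg b;
  factorization : forall (l : mor) (m n : 'rV[nat]_k), deg l = m + n ->
    exists! ab : mor * mor, [/\ src ab.1 = rng ab.2,
      deg ab.1 = m, deg ab.2 = n & l = mcomp ab.1 ab.2]
}.

Definition paths k (L : kgraph k) (v : vert L) (n : 'rV[nat]_k) : set (mor L) :=
  [set a | deg a = n /\ rng a = v].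

Definition row_finite k (L : kgraph k) : Prop :=
  forall (v : vert L) n, finite_set (paths v n).

Definition no_sources k (L : kgraph k) : Prop :=
  forall (v : vert L) n, paths v n !=set0.

Definition toZ k (n : 'rV[nat]_k) : 'rV[int]_k := map_mx Posz n.

Lemma toZD k (m n : 'rV[nat]_k) : toZ (m + n) = toZ m + toZ n.
Proof. by apply/rowP => i; rewrite !mxE PoszD. Qed.

(* T_L is the quotient of the terms built from the generators v(n) by the
   least congruence containing the laws of commutative monoids and the
   defining relations. *)
Inductive Tterm k (L : kgraph k) : Type :=
| Tgen of vert L & 'rV[int]_k
| Tzero
| Tadd of Tterm L & Tterm L.
Arguments Tzero {k L}.

(* For an infinite set A, [fset_set A] is empty; this does not occur when L is
   row-finite. *)
Inductive Teq k (L : kgraph k) : Tterm L -> Tterm L -> Prop :=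
| Teq_refl t : Teq t t
| Teq_sym t u : Teq t u -> Teq u t
| Teq_trans t u w : Teq t u -> Teq u w -> Teq t w
| Teq_add t t' u u' : Teq t t' -> Teq u u' -> Teq (Tadd t u) (Tadd t' u')
| Teq_addA t u w : Teq (Tadd t (Tadd u w)) (Tadd (Tadd t u) w)
| Teq_addC t u : Teq (Tadd t u) (Tadd u t)
| Teq_add0 t : Teq (Tadd Tzero t) t
| Teq_rel (v : vert L) (n : 'rV[int]_k) (m : 'rV[nat]_k) :
    Teq (Tgen v n)
        (\big[@Tadd k L/Tzero]_(a <- fset_set (paths v m))
           Tgen (src a) (n + toZ m)).

HB.instance Definition _ k (L : kgraph k) := gen_eqMixin (Tterm L).
HB.instance Definition _ k (L : kgraph k) := gen_choiceMixin (Tterm L).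

Section TalentedMonoid.
Variables (k : nat) (L : kgraph k).

Let Teqb (t u : Tterm L) : bool := `[< Teq t u >].

Let Teqb_equiv : equiv_class_of Teqb.
Proof.
split=> [t|t u|u t w].
- exact/asboolP/Teq_refl.
- by apply/asboolP/asboolP; exact: Teq_sym.
- by move=> /asboolP tu /asboolP uw; apply/asboolP/(Teq_trans tu uw).
Qed.

Canonical Teq_equiv := EquivRelPack Teqb_equiv.

Definition talented := {eq_quot Teq_equiv}.
HB.instance Definition _ := Choice.on talented.
HB.instance Definition _ := EqQuotient.on talented.

Lemma talented_eqP (t u : Tterm L) :
  (\pi_talented t = \pi_talented u) <-> Teq t u.
Proof.
split; first by move/eqmodP/asboolP.
by move=> tu; apply/eqmodP/asboolP.
Qed.

Lemma talented_reprK (t : Tterm L) : Teq (repr (\pi_talented t)) t.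
Proof. by apply/talented_eqP; rewrite reprK. Qed.

Definition talented_zero : talented := \pi_talented Tzero.
Definition talented_add (x y : talented) : talented :=
  \pi_talented (Tadd (repr x) (repr y)).

Lemma talented_addE t u :
  talented_add (\pi_talented t) (\pi_talented u) = \pi_talented (Tadd t u).
Proof. by apply/talented_eqP/Teq_add; exact: talented_reprK. Qed.

Let addA : associative talented_add.
Proof.
elim/quotW=> t; elim/quotW=> u; elim/quotW=> w.
rewrite (talented_addE u) (talented_addE t) (talented_addE t u) talented_addE.
exact/talented_eqP/Teq_addA.
Qed.

Let addC : commutative talented_add.
Proof.
elim/quotW=> t; elim/quotW=> u.
rewrite (talented_addE t) (talented_addE u).
exact/talented_eqP/Teq_addC.
Qed.

Let add0 : left_id talented_zero talented_add.
Proof.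
by elim/quotW=> t; rewrite /talented_zero talented_addE;
   exact/talented_eqP/Teq_add0.
Qed.

HB.instance Definition _ := GRing.isNmodule.Build talented addA addC add0.

Definition tgen (v : vert L) (n : 'rV[int]_k) : talented :=
  \pi_talented (Tgen v n).

Fixpoint Tshift (q : 'rV[int]_k) (t : Tterm L) : Tterm L :=
  match t with
  | Tgen v n => Tgen v (n + q)
  | Tzero => Tzero
  | Tadd t u => Tadd (Tshift q t) (Tshift q u)
  end.

Lemma Teq_shift q t u : Teq t u -> Teq (Tshift q t) (Tshift q u).
Proof.
elim=> {t u} /=.
- by move=> t; exact: Teq_refl.
- by move=> t u _; exact: Teq_sym.
- by move=> t u w _ tu _; exact: Teq_trans.
- by move=> t t' u u' _ tt' _; exact: Teq_add.
- by move=> *; exact: Teq_addA.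
- by move=> *; exact: Teq_addC.
- by move=> *; exact: Teq_add0.
- move=> v n m.
  rewrite (big_morph (Tshift q) (id1 := Tzero) (op1 := @Tadd k L)) //=.
  under eq_bigr do rewrite addrAC.
  exact: Teq_rel.
Qed.

Definition tshift (q : 'rV[int]_k) (x : talented) : talented :=
  \pi_talented (Tshift q (repr x)).

Lemma tshiftE q t : tshift q (\pi_talented t) = \pi_talented (Tshift q t).
Proof. exact/talented_eqP/Teq_shift/talented_reprK. Qed.

Lemma tshift_gen q v n : tshift q (tgen v n) = tgen v (n + q).
Proof. exact: tshiftE. Qed.

Definition tle (x y : talented) : Prop := exists z, y = x + z.

Definition Zk_order_ideal (J : set talented) : Prop :=
  [/\ J 0,
      forall x y, J x -> J y -> J (x + y),
      forall x y, tle x y -> J y -> J x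
    & forall q x, J x -> J (tshift q x)].

Definition decomposable : Prop :=
  exists J1 J2 : set talented,
    [/\ Zk_order_ideal J1 /\ J1 <> setT, Zk_order_ideal J2 /\ J2 <> setT,
        J1 `&` J2 = [set 0]
      & smallest Zk_order_ideal (J1 `|` J2) = setT].

Definition indecomposable : Prop := ~ decomposable.

End TalentedMonoid.

(* [is_dsum A F]: the subset A of V is the internal direct sum of the F n. *)
Definition is_dsum (V : zmodType) (N : choiceType) (A : set V)
    (F : N -> set V) : Prop :=
  A = [set x | exists2 l : seq (N * V),
         (forall p, p \in l -> F p.1 p.2) & x = \sum_(p <- l) p.2] /\
  (forall (s : seq N) (f : N -> V), uniq s ->
     (forall n, n \in s -> F n (f n)) ->
     \sum_(n <- s) f n = 0 -> forall n, n \in s -> f n = 0).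

(* Associative rings, not necessarily unital, graded by the group N. *)
Record gradedRing (N : zmodType) := GradedRing {
  gr_sort :> zmodType;
  gr_mul : gr_sort -> gr_sort -> gr_sort;
  gr_mulA : associative gr_mul;
  gr_mulDl : left_distributive gr_mul +%R;
  gr_mulDr : right_distributive gr_mul +%R;
  gr_comp : N -> set gr_sort;
  gr_comp0 : forall n, gr_comp n 0;
  gr_compB : forall n x y, gr_comp n x -> gr_comp n y -> gr_comp n (x - y);
  gr_compM : forall m n x y, gr_comp m x -> gr_comp n y ->
    gr_comp (m + n) (gr_mul x y);
  gr_dsum : is_dsum [set: gr_sort] gr_comp
}.

Section GradedIdeals.
Variables (N : zmodType) (R : gradedRing N).
Implicit Types I J P : set R.
Local Notation "x ** y" := (@gr_mul N R x y) (at level 40, left associativity).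

(* Ideals are not required to be stable under scalars: in KP(L) this is
   automatic, since KP(L) has local units. *)
Definition ring_ideal I : Prop :=
  [/\ I 0, forall x y, I x -> I y -> I (x - y),
      forall a x, I x -> I (a ** x) & forall a x, I x -> I (x ** a)].

Definition graded_ideal I : Prop :=
  ring_ideal I /\ is_dsum I (fun n => I `&` gr_comp n).

Definition ideal_mul I J : set R :=
  [set x | exists2 l : seq (R * R),
     (forall p, p \in l -> I p.1 /\ J p.2) & x = \sum_(p <- l) p.1 ** p.2].

Definition graded_prime P : Prop :=
  [/\ graded_ideal P, P <> setT
    & forall I J, graded_ideal I -> graded_ideal J ->
        ideal_mul I J `<=` P -> I `<=` P \/ J `<=` P].

Record grSpec := GrSpec {
  gr_ideal :> set R;
  gr_idealP : graded_prime gr_ideal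
}.

Definition Vgr I : set grSpec := [set P | I `<=` gr_ideal P].

Let mul0 x : 0 ** x = 0.
Proof. by apply: (addrI (0 ** x)); rewrite -gr_mulDl !addr0. Qed.

Let mulr0 x : x ** 0 = 0.
Proof. by apply: (addrI (x ** 0)); rewrite -gr_mulDr !addr0. Qed.

Let mulN x y : (- x) ** y = - (x ** y).
Proof. by apply/eqP; rewrite -subr_eq0 opprK -gr_mulDl addNr mul0. Qed.

Let mul_suml T (s : seq T) (F : T -> R) x :
  (\sum_(i <- s) F i) ** x = \sum_(i <- s) F i ** x.
Proof. exact: (big_morph (fun y => y ** x) (fun a b => gr_mulDl a b x)). Qed.

Let mul_sumr T (s : seq T) (F : T -> R) x :
  x ** (\sum_(i <- s) F i) = \sum_(i <- s) x ** F i.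
Proof. exact: (big_morph (fun y => x ** y) (fun a b => gr_mulDr x a b)). Qed.

Lemma ring_ideal_sum I (T : eqType) (s : seq T) (F : T -> R) : ring_ideal I ->
  (forall i, i \in s -> I (F i)) -> I (\sum_(i <- s) F i).
Proof.
move=> [I0 IB _ _] IF; rewrite big_seq; elim/big_ind: _ => // x y Ix Iy.
by rewrite -[y]opprK; apply: (IB) => //; rewrite -[- y]add0r; exact: IB.
Qed.

Lemma graded_idealP I : ring_ideal I ->
  (forall x, I x -> exists2 l : seq R,
     (forall y, y \in l -> exists2 n, I y & gr_comp n y) &
     x = \sum_(y <- l) y) -> graded_ideal I.
Proof.
move=> idI spI; split=> //; split; last first.
  move=> s f us If; apply: (proj2 (gr_dsum R)) => // n ns.
  by have [] := If n ns.
apply/seteqP; split=> x /=; last first.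
  by move=> [l Il ->]; apply: ring_ideal_sum => // p /Il[].
move=> /spI[l Il ->] {x}; elim: l Il => [|y l IHl] Il.
  by exists [::]; rewrite // !big_nil.
have [|l' Il' eql] := IHl; first by move=> z zl; apply: Il; rewrite inE zl orbT.
have [n Iy ny] := Il y (mem_head _ _).
exists ((n, y) :: l'); last by rewrite !big_cons eql.
by move=> p; rewrite inE => /predU1P[->|/Il'].
Qed.

Lemma graded_ideal_span I x : graded_ideal I -> I x ->
  exists2 l : seq (N * R), (forall p, p \in l -> I p.2 /\ gr_comp p.1 p.2) &
     x = \sum_(p <- l) p.2.
Proof. by move=> [_ [IE _]]; rewrite {1}IE => -[l Il ->]; exists l. Qed.

Lemma graded_idealT : graded_ideal setT.
Proof.
split; first by split.
rewrite (_ : (fun n => _) = @gr_comp N R); first exact: gr_dsum.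
by apply/funext => n; rewrite setTI.
Qed.

Lemma ideal_mulE I J x y : I x -> J y -> ideal_mul I J (x ** y).
Proof.
move=> Ix Jy; exists [:: (x, y)]; last by rewrite big_seq1.
by move=> p; rewrite inE => /eqP ->.
Qed.

Lemma ring_ideal_mul I J : ring_ideal I -> ring_ideal J ->
  ring_ideal (ideal_mul I J).
Proof.
move=> [I0 IB Il Ir] [J0 JB Jl Jr]; split.
- by exists [::]; rewrite // big_nil.
- move=> x y [l Hl ->] [l' Hl' ->].
  exists (l ++ [seq (- p.1, p.2) | p <- l']).
    move=> p; rewrite mem_cat => /orP[/Hl //|/mapP[q /Hl'[Iq Jq] ->]] /=.
    by split=> //; rewrite -[- _]add0r; exact: IB.
  rewrite big_cat big_map -sumrN; congr (_ + _).
  by apply: eq_bigr => p _; rewrite mulN.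
- move=> a x [l Hl ->]; exists [seq (a ** p.1, p.2) | p <- l].
    by move=> p /mapP[q /Hl[Iq Jq] ->] /=; split=> //; exact: Il.
  by rewrite big_map mul_sumr; apply: eq_bigr => p _; rewrite gr_mulA.
- move=> a x [l Hl ->]; exists [seq (p.1, p.2 ** a) | p <- l].
    by move=> p /mapP[q /Hl[Iq Jq] ->] /=; split=> //; exact: Jr.
  by rewrite big_map mul_suml; apply: eq_bigr => p _; rewrite gr_mulA.
Qed.

Lemma graded_ideal_mul I J : graded_ideal I -> graded_ideal J ->
  graded_ideal (ideal_mul I J).
Proof.
move=> gI gJ; apply: graded_idealP; first exact: ring_ideal_mul gI.1 gJ.1.
move=> x [l Hl ->] {x}; elim: l Hl => [|[a b] l IHl] Hl.
  by exists [::]; rewrite // !big_nil.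
have [|l' Il' eql] := IHl; first by move=> z zl; apply: Hl; rewrite inE zl orbT.
have [Ia Jb] := Hl _ (mem_head _ _).
have [la Ila /= ->] := graded_ideal_span gI Ia.
have [lb Ilb /= ->] := graded_ideal_span gJ Jb.
exists ([seq p.2 ** q.2 | p <- la, q <- lb] ++ l'); last first.
  rewrite big_cons big_cat eql /=; congr (_ + _).
  rewrite big_allpairs_dep mul_suml; apply: eq_bigr => p _.
  by rewrite mul_sumr.
move=> y; rewrite mem_cat => /orP[|/Il' //].
move=> /allpairsP[[p q] /= [/Ila[Ip hp] /Ilb[Jq hq] ->]].
by exists (p.1 + q.1); [exact: ideal_mulE|exact: gr_compM].
Qed.

Lemma Vgr_mul I J : graded_ideal I -> graded_ideal J ->
  Vgr (ideal_mul I J) = Vgr I `|` Vgr J.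
Proof.
move=> gI gJ; apply/seteqP; split=> P /=.
  by have [_ _ prP] := gr_idealP P; exact: prP.
have [[idP _] _ _] := gr_idealP P; have [_ _ Pl Pr] := idP.
move=> IJP x [l Hl ->]; apply: ring_ideal_sum => // p /Hl[Ip Jp].
by case: IJP => [IP|JP]; [apply: Pr; exact: IP|apply: Pl; exact: JP].
Qed.

Definition ideal_sum (S : set (set R)) : set R :=
  [set x | exists2 l : seq R,
     (forall y, y \in l -> exists2 I, S I & I y) & x = \sum_(y <- l) y].

Lemma ring_ideal_sumI (S : set (set R)) : S `<=` ring_ideal ->
  ring_ideal (ideal_sum S).
Proof.
move=> Sid; split.
- by exists [::]; rewrite // big_nil.
- move=> x y [l Hl ->] [l' Hl' ->]; exists (l ++ [seq - z | z <- l']).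
    move=> z; rewrite mem_cat => /orP[/Hl //|/mapP[t /Hl'[I SI It] ->]].
    by exists I => //; have [I0 IB _ _] := Sid _ SI;
       rewrite -[- t]add0r; exact: IB.
  by rewrite big_cat big_map sumrN.
- move=> a x [l Hl ->]; exists [seq a ** z | z <- l].
    move=> z /mapP[t /Hl[I SI It] ->]; exists I => //.
    by have [_ _ Il _] := Sid _ SI; exact: Il.
  by rewrite big_map mul_sumr.
- move=> a x [l Hl ->]; exists [seq z ** a | z <- l].
    move=> z /mapP[t /Hl[I SI It] ->]; exists I => //.
    by have [_ _ _ Ir] := Sid _ SI; exact: Ir.
  by rewrite big_map mul_suml.
Qed.

Lemma ideal_sum_sup (S : set (set R)) I : S I -> I `<=` ideal_sum S.
Proof.
move=> SI x Ix; exists [:: x]; last by rewrite big_seq1.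
by move=> y; rewrite inE => /eqP ->; exists I.
Qed.

Lemma graded_ideal_sum (S : set (set R)) : S `<=` graded_ideal ->
  graded_ideal (ideal_sum S).
Proof.
move=> Sgr; apply: graded_idealP; first by apply: ring_ideal_sumI => I /Sgr[].
move=> x [l Hl ->] {x}; elim: l Hl => [|a l IHl] Hl.
  by exists [::]; rewrite // !big_nil.
have [|l' Il' eql] := IHl; first by move=> z zl; apply: Hl; rewrite inE zl orbT.
have [I SI Ia] := Hl _ (mem_head _ _).
have [la Ila ->] := graded_ideal_span (Sgr _ SI) Ia.
exists ([seq p.2 | p <- la] ++ l'); last
  by rewrite big_cons big_cat big_map eql.
move=> y; rewrite mem_cat => /orP[/mapP[p /Ila[Ip hp] ->]|/Il' //].
by exists p.1 => //; exact: ideal_sum_sup SI _ Ip.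
Qed.

Definition gr_open : set_system grSpec :=
  [set U | exists2 I, graded_ideal I & U = ~` Vgr I].

Let gr_openT : gr_open setT.
Proof.
exists setT; first exact: graded_idealT.
apply/seteqP; split=> // P _ /= TP; have [_ nP _] := gr_idealP P; apply: nP.
by apply/seteqP; split.
Qed.

Let gr_openI : setI_closed gr_open.
Proof.
move=> U W [I gI ->] [J gJ ->]; exists (ideal_mul I J).
  exact: graded_ideal_mul.
by rewrite Vgr_mul // setCU.
Qed.

Let gr_open_bigU (T : Type) (f : T -> set grSpec) :
  (forall i, gr_open (f i)) -> gr_open (\bigcup_i f i).
Proof.
move=> fo; pose S := [set I | graded_ideal I /\ exists i, f i = ~` Vgr I].
exists (ideal_sum S); first by apply: graded_ideal_sum => I [].
apply/seteqP; split=> P.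
  move=> [i _]; have [I gI fi] := fo i; rewrite fi => nIP /= SP; apply: nIP.
  move=> x Ix; apply: SP; apply: ideal_sum_sup Ix.
  by split=> //; exists i.
move=> /= nSP; apply: contrapT => nfP; apply: nSP => x [l Hl ->].
have [[idP _] _ _] := gr_idealP P.
apply: ring_ideal_sum => // y /Hl[I [gI [i fi]] Iy].
apply: contrapT => nPy; apply: nfP; exists i => //; rewrite fi => /= IP.
by apply: nPy; exact: IP.
Qed.

HB.instance Definition _ := gen_eqMixin grSpec.
HB.instance Definition _ := gen_choiceMixin grSpec.
HB.instance Definition _ :=
  isOpenTopological.Build grSpec gr_openT gr_openI gr_open_bigU.

Lemma closed_grSpecP (C : set grSpec) :
  closed C <-> exists2 I, graded_ideal I & C = Vgr I.
Proof.
rewrite -openC; split=> [[I gI CI]|[I gI ->]]; exists I => //.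
by rewrite -[C]setCK CI setCK.
Qed.

End GradedIdeals.

Section KPgenerators.
Variables (k : nat) (L : kgraph k).

(* L^0 = d^-1(0) is the set of identities, by unique factorization. *)
Definition npath := {a : mor L | deg a != 0}.

Inductive KPgen : Type :=
| KPp of vert L
| KPs of npath
| KPg of npath.

Definition KPgen_deg (g : KPgen) : 'rV[int]_k :=
  match g with
  | KPp _ => 0
  | KPs a => toZ (deg (val a))
  | KPg a => - toZ (deg (val a))
  end.

Definition npaths (v : vert L) (n : 'rV[nat]_k) : set npath :=
  [set a | paths v n (val a)].

End KPgenerators.
Arguments KPp {k L}.
Arguments KPs {k L}.
Arguments KPg {k L}.

(* KP(L) is the quotient of the nonunital algebra terms built from the
   generators by the least congruence containing the laws of associative
   K-algebras and the defining relations. *)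
Inductive KPterm (K : fieldType) k (L : kgraph k) : Type :=
| Kgen of KPgen L
| Kzero
| Kadd of KPterm K L & KPterm K L
| Kscale of K & KPterm K L
| Kmul of KPterm K L & KPterm K L.
Arguments Kgen {K k L}.
Arguments Kzero {K k L}.

Section KPrelations.
Variables (K : fieldType) (k : nat) (L : kgraph k).
Implicit Types (t u w : KPterm K L) (a b c : npath L) (v : vert L).

Local Notation p v := (Kgen (KPp v)).
Local Notation s a := (Kgen (KPs a)).
Local Notation "s^* a" := (Kgen (KPg a)) (at level 10, a at level 9).
Local Notation "x ** y" := (Kmul x y) (at level 40, left associativity).
Local Notation r a := (rng (val a)).
Local Notation d a := (src (val a)).

(* The relations involving a composite are stated for any element c of L
   outside L^0 that is equal to the composite; this composite always has
   nonzero degree. *)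
Inductive KPrel : KPterm K L -> KPterm K L -> Prop :=
| KPrel_pp v v' : KPrel (p v ** p v') (if v == v' then p v else Kzero)
| KPrel_ss a b c : d a = r b -> val c = mcomp (val a) (val b) ->
    KPrel (s a ** s b) (s c)
| KPrel_gg a b c : d a = r b -> val c = mcomp (val a) (val b) ->
    KPrel (s^* b ** s^* a) (s^* c)
| KPrel_ps a : KPrel (p (r a) ** s a) (s a)
| KPrel_sp a : KPrel (s a ** p (d a)) (s a)
| KPrel_pg a : KPrel (p (d a) ** s^* a) (s^* a)
| KPrel_gp a : KPrel (s^* a ** p (r a)) (s^* a)
| KPrel_gs a b : deg (val a) = deg (val b) ->
    KPrel (s^* a ** s b) (if a == b then p (d a) else Kzero)
| KPrel_sum v (n : 'rV[nat]_k) : n != 0 ->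
    KPrel (p v)
      (\big[@Kadd K k L/Kzero]_(a <- fset_set (npaths v n)) (s a ** s^* a)).

Inductive KPeq : KPterm K L -> KPterm K L -> Prop :=
| KPeq_rel t u : KPrel t u -> KPeq t u
| KPeq_refl t : KPeq t t
| KPeq_sym t u : KPeq t u -> KPeq u t
| KPeq_trans t u w : KPeq t u -> KPeq u w -> KPeq t w
| KPeq_add t t' u u' : KPeq t t' -> KPeq u u' -> KPeq (Kadd t u) (Kadd t' u')
| KPeq_scale x t t' : KPeq t t' -> KPeq (Kscale x t) (Kscale x t')
| KPeq_mul t t' u u' : KPeq t t' -> KPeq u u' -> KPeq (t ** u) (t' ** u')
| KPeq_addA t u w : KPeq (Kadd t (Kadd u w)) (Kadd (Kadd t u) w)
| KPeq_addC t u : KPeq (Kadd t u) (Kadd u t)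
| KPeq_add0 t : KPeq (Kadd Kzero t) t
| KPeq_scale0 t : KPeq (Kscale 0 t) Kzero
| KPeq_scale1 t : KPeq (Kscale 1 t) t
| KPeq_scaleA x y t : KPeq (Kscale x (Kscale y t)) (Kscale (x * y) t)
| KPeq_scaleDl x y t :
    KPeq (Kscale (x + y) t) (Kadd (Kscale x t) (Kscale y t))
| KPeq_scaleDr x t u :
    KPeq (Kscale x (Kadd t u)) (Kadd (Kscale x t) (Kscale x u))
| KPeq_mulA t u w : KPeq (t ** (u ** w)) ((t ** u) ** w)
| KPeq_mulDl t u w : KPeq (Kadd t u ** w) (Kadd (t ** w) (u ** w))
| KPeq_mulDr t u w : KPeq (t ** Kadd u w) (Kadd (t ** u) (t ** w))
| KPeq_scaleAl x t u : KPeq (Kscale x (t ** u)) (Kscale x t ** u)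
| KPeq_scaleAr x t u : KPeq (Kscale x (t ** u)) (t ** Kscale x u).

End KPrelations.

HB.instance Definition _ (K : fieldType) k (L : kgraph k) :=
  gen_eqMixin (KPterm K L).
HB.instance Definition _ (K : fieldType) k (L : kgraph k) :=
  gen_choiceMixin (KPterm K L).

Section KPalgebra.
Variables (K : fieldType) (k : nat) (L : kgraph k).
Implicit Types (t u w : KPterm K L).

Let KPeqb t u : bool := `[< KPeq t u >].

Let KPeqb_equiv : equiv_class_of KPeqb.
Proof.
split=> [t|t u|u t w].
- exact/asboolP/KPeq_refl.
- by apply/asboolP/asboolP; exact: KPeq_sym.
- by move=> /asboolP tu /asboolP uw; apply/asboolP/(KPeq_trans tu uw).
Qed.

Canonical KPeq_equiv := EquivRelPack KPeqb_equiv.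

Definition KPalg := {eq_quot KPeq_equiv}.
HB.instance Definition _ := Choice.on KPalg.
HB.instance Definition _ := EqQuotient.on KPalg.

Lemma KPalg_eqP t u : (\pi_KPalg t = \pi_KPalg u) <-> KPeq t u.
Proof.
split; first by move/eqmodP/asboolP.
by move=> tu; apply/eqmodP/asboolP.
Qed.

Lemma KPalg_reprK t : KPeq (repr (\pi_KPalg t)) t.
Proof. by apply/KPalg_eqP; rewrite reprK. Qed.

Definition KP_zero : KPalg := \pi_KPalg Kzero.
Definition KP_add (x y : KPalg) : KPalg := \pi_KPalg (Kadd (repr x) (repr y)).
Definition KP_scale (a : K) (x : KPalg) : KPalg :=
  \pi_KPalg (Kscale a (repr x)).
Definition KP_opp (x : KPalg) : KPalg := KP_scale (-1) x.
Definition KP_mul (x y : KPalg) : KPalg := \pi_KPalg (Kmul (repr x) (repr y)).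
Definition KP_gen (g : KPgen L) : KPalg := \pi_KPalg (Kgen g).

Let addE t u : KP_add (\pi_KPalg t) (\pi_KPalg u) = \pi_KPalg (Kadd t u).
Proof. by apply/KPalg_eqP/KPeq_add; exact: KPalg_reprK. Qed.

Let scaleE a t : KP_scale a (\pi_KPalg t) = \pi_KPalg (Kscale a t).
Proof. by apply/KPalg_eqP/KPeq_scale; exact: KPalg_reprK. Qed.

Let mulE t u : KP_mul (\pi_KPalg t) (\pi_KPalg u) = \pi_KPalg (Kmul t u).
Proof. by apply/KPalg_eqP/KPeq_mul; exact: KPalg_reprK. Qed.

Let addA : associative KP_add.
Proof.
elim/quotW=> t; elim/quotW=> u; elim/quotW=> w.
rewrite (addE u) (addE t) (addE t u) addE.
exact/KPalg_eqP/KPeq_addA.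
Qed.

Let addC : commutative KP_add.
Proof.
by elim/quotW=> t; elim/quotW=> u; rewrite (addE t) (addE u);
   exact/KPalg_eqP/KPeq_addC.
Qed.

Let add0 : left_id KP_zero KP_add.
Proof. by elim/quotW=> t; rewrite addE; exact/KPalg_eqP/KPeq_add0. Qed.

Let scale1 : left_id 1 KP_scale.
Proof. by elim/quotW=> t; rewrite scaleE; exact/KPalg_eqP/KPeq_scale1. Qed.

Let scaleDl x : {morph KP_scale^~ x : a b / a + b >-> KP_add a b}.
Proof.
elim/quotW: x => t a b; rewrite (scaleE a) (scaleE b) scaleE addE.
exact/KPalg_eqP/KPeq_scaleDl.
Qed.

Let addN : left_inverse KP_zero KP_opp KP_add.
Proof.
move=> x; rewrite -[X in KP_add _ X]scale1 -scaleDl addNr.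
by elim/quotW: x => t; rewrite scaleE; exact/KPalg_eqP/KPeq_scale0.
Qed.

HB.instance Definition _ := GRing.isZmodule.Build KPalg addA addC add0 addN.

Let scaleA a b x : KP_scale a (KP_scale b x) = KP_scale (a * b) x.
Proof.
by elim/quotW: x => t; rewrite (scaleE b) (scaleE a) scaleE;
   exact/KPalg_eqP/KPeq_scaleA.
Qed.

Let scaleDr : right_distributive KP_scale +%R.
Proof.
move=> a; elim/quotW=> t; elim/quotW=> u; rewrite [X in KP_scale _ X]addE.
by rewrite !scaleE [RHS]addE; exact/KPalg_eqP/KPeq_scaleDr.
Qed.

HB.instance Definition _ :=
  GRing.Zmodule_isLmodule.Build K KPalg scaleA scale1 scaleDr scaleDl.

Lemma KP_addE t u : \pi_KPalg t + \pi_KPalg u = \pi_KPalg (Kadd t u).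
Proof. exact: addE. Qed.

Lemma KP_scaleE a t : a *: \pi_KPalg t = \pi_KPalg (Kscale a t).
Proof. exact: scaleE. Qed.

Lemma KP_mulE t u : KP_mul (\pi_KPalg t) (\pi_KPalg u) = \pi_KPalg (Kmul t u).
Proof. exact: mulE. Qed.

Lemma KP_mulA : associative KP_mul.
Proof.
elim/quotW=> t; elim/quotW=> u; elim/quotW=> w.
rewrite (KP_mulE u) (KP_mulE t) (KP_mulE t u) KP_mulE.
exact/KPalg_eqP/KPeq_mulA.
Qed.

Lemma KP_mulDl : left_distributive KP_mul +%R.
Proof.
elim/quotW=> t; elim/quotW=> u; elim/quotW=> w;
rewrite (KP_addE t u) (KP_mulE t) (KP_mulE u) KP_mulE KP_addE.
exact/KPalg_eqP/KPeq_mulDl.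
Qed.

Lemma KP_mulDr : right_distributive KP_mul +%R.
Proof.
elim/quotW=> t; elim/quotW=> u; elim/quotW=> w;
rewrite (KP_addE u w) (KP_mulE t u) (KP_mulE t w) KP_mulE KP_addE.
exact/KPalg_eqP/KPeq_mulDr.
Qed.

Lemma KP_scaleAl a x y : a *: KP_mul x y = KP_mul (a *: x) y.
Proof.
elim/quotW: x => t; elim/quotW: y => u.
rewrite (KP_mulE t) (KP_scaleE a t) KP_mulE KP_scaleE.
exact/KPalg_eqP/KPeq_scaleAl.
Qed.

Lemma KP_scaleAr a x y : a *: KP_mul x y = KP_mul x (a *: y).
Proof.
elim/quotW: x => t; elim/quotW: y => u.
rewrite (KP_mulE t) (KP_scaleE a u) KP_mulE KP_scaleE.
exact/KPalg_eqP/KPeq_scaleAr.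
Qed.

(* The homogeneous components: the least family of subspaces which contains
   the generators in their degrees and is compatible with products. *)
Inductive KP_comp : 'rV[int]_k -> KPalg -> Prop :=
| KP_comp_gen g : KP_comp (KPgen_deg g) (KP_gen g)
| KP_comp_zero n : KP_comp n 0
| KP_comp_add n x y : KP_comp n x -> KP_comp n y -> KP_comp n (x + y)
| KP_comp_scale n (a : K) x : KP_comp n x -> KP_comp n (a *: x)
| KP_comp_mul m n x y : KP_comp m x -> KP_comp n y ->
    KP_comp (m + n) (KP_mul x y).

(* To see that the sum of the components is direct, let KP(L) act on the
   functions from Z^k to its unitization K x KP(L), a generator of degree m
   acting by left multiplication followed by a shift by m. *)
Let U := (K^o * KPalg)%type.

Let lmul (x : KPalg) (z : U) : U := (0, (z.1 : K) *: x + KP_mul x z.2).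

Fixpoint KP_act t (f : 'rV[int]_k -> U) (n : 'rV[int]_k) : U :=
  match t with
  | Kgen g => lmul (KP_gen g) (f (n - KPgen_deg g))
  | Kzero => 0
  | Kadd t u => KP_act t f n + KP_act u f n
  | Kscale a t => a *: KP_act t f n
  | Kmul t u => KP_act t (KP_act u f) n
  end.

Let mul0x x : KP_mul 0 x = 0.
Proof. by apply: (addrI (KP_mul 0 x)); rewrite -KP_mulDl !addr0. Qed.

Let mulx0 x : KP_mul x 0 = 0.
Proof. by apply: (addrI (KP_mul x 0)); rewrite -KP_mulDr !addr0. Qed.

Let lmulDr x z z' : lmul x (z + z') = lmul x z + lmul x z'.
Proof.
by congr pair; rewrite /= ?addr0 // scalerDl KP_mulDr addrACA.
Qed.

Let lmulZr x a z : lmul x (a *: z) = a *: lmul x z.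
Proof.
congr pair; rewrite /= ?scaler0 //.
by rewrite scalerDr scalerA KP_scaleAr.
Qed.

Let lmulDl x y z : lmul (x + y) z = lmul x z + lmul y z.
Proof. by congr pair; rewrite /= ?addr0 // scalerDr KP_mulDl addrACA. Qed.

Let lmulZl x a z : lmul (a *: x) z = a *: lmul x z.
Proof.
congr pair; rewrite /= ?scaler0 // scalerDr KP_scaleAl !scalerA mulrC.
by [].
Qed.

Let lmulM x y z : lmul (KP_mul x y) z = lmul x (lmul y z).
Proof.
by congr pair; rewrite /= scale0r add0r KP_mulDr KP_mulA KP_scaleAr.
Qed.

Let lmul0 z : lmul 0 z = 0.
Proof. by congr pair; rewrite /= scaler0 mul0x addr0. Qed.

Let act_ext t f g : f =1 g -> KP_act t f =1 KP_act t g.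
Proof. by move=> /funext ->. Qed.

Let actD t f g n :
  KP_act t (fun m => f m + g m) n = KP_act t f n + KP_act t g n.
Proof.
elim: t f g n => [h||t IHt u IHu|a t IHt|t IHt u IHu] f g n /=.
- exact: lmulDr.
- by rewrite addr0.
- by rewrite IHt IHu addrACA.
- by rewrite IHt scalerDr.
- by rewrite -IHt; apply: act_ext => m; exact: IHu.
Qed.

Let actZ t a f n : KP_act t (fun m => a *: f m) n = a *: KP_act t f n.
Proof.
elim: t f n => [h||t IHt u IHu|b t IHt|t IHt u IHu] f n /=.
- exact: lmulZr.
- by rewrite scaler0.
- by rewrite IHt IHu scalerDr.
- by rewrite IHt !scalerA mulrC.
- by rewrite -IHt; apply: act_ext => m; exact: IHu.
Qed.

Let homog m t := forall f n, KP_act t f n = lmul (\pi_KPalg t) (f (n - m)).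

Let homog_gen g : homog (KPgen_deg g) (Kgen g).
Proof. by []. Qed.

Let homog0 m : homog m Kzero.
Proof. by move=> f n /=; rewrite (lmul0 _). Qed.

Let homogD m t u : homog m t -> homog m u -> homog m (Kadd t u).
Proof. by move=> ht hu f n /=; rewrite ht hu -lmulDl KP_addE. Qed.

Let homogZ m a t : homog m t -> homog m (Kscale a t).
Proof. by move=> ht f n /=; rewrite ht -lmulZl KP_scaleE. Qed.

Let homogM m m' t u : homog m t -> homog m' u -> homog (m + m') (Kmul t u).
Proof.
by move=> ht hu f n /=; rewrite ht hu -lmulM KP_mulE opprD addrA.
Qed.

Let homog_cast m m' t : m = m' -> homog m t -> homog m' t.
Proof. by move=> ->. Qed.

Let rel_homog t u : KPrel t u -> exists m, homog m t /\ homog m u.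
Proof.
case=> {t u}.
- move=> u v; exists 0; split; last by case: ifP.
  by rewrite -[0]addr0; exact: homogM.
- move=> a b c ab cE; exists (toZ (deg (val c))); split=> //.
  by rewrite cE deg_comp // toZD; exact: homogM.
- move=> a b c ab cE; exists (- toZ (deg (val c))); split=> //.
  by rewrite cE deg_comp // toZD addrC opprD; exact: homogM.
- move=> a; exists (toZ (deg (val a))); split=> //.
  by rewrite -[toZ _]add0r; exact: homogM.
- move=> a; exists (toZ (deg (val a))); split=> //.
  by rewrite -[toZ _]addr0; exact: homogM.
- move=> a; exists (- toZ (deg (val a))); split=> //.
  by rewrite -[- toZ _]add0r; exact: homogM.
- move=> a; exists (- toZ (deg (val a))); split=> //.
  by rewrite -[- toZ _]addr0; exact: homogM.
- move=> a b ab; exists 0; split; last by case: ifP.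
  by rewrite -(addNr (toZ (deg (val a)))) [in X in _ + X]ab; exact: homogM.
- move=> v n n0; exists 0; split=> //.
  elim/big_ind: _ => // [t u|a _]; first exact: homogD.
  by rewrite -(addrN (toZ (deg (val a)))); exact: homogM.
Qed.

Let act_KPeq t u : KPeq t u -> KP_act t = KP_act u.
Proof.
move=> tu; apply/funext => f; apply/funext => n; elim: tu f n => {t u} /=.
- move=> t u tu f n; have [m [ht hu]] := rel_homog tu.
  by rewrite ht hu; congr lmul; exact/KPalg_eqP/KPeq_rel.
- by [].
- by [].
- by move=> t u w _ tu _ uw f n; rewrite tu uw.
- by move=> t t' u u' _ tt' _ uu' f n; rewrite tt' uu'.
- by move=> a t t' _ tt' f n; rewrite tt'.
- by move=> t t' u u' _ tt' _ uu' f n; rewrite tt'; apply: act_ext => m.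
- by move=> *; rewrite addrA.
- by move=> *; rewrite addrC.
- by move=> *; rewrite add0r.
- by move=> *; rewrite scale0r.
- by move=> *; rewrite scale1r.
- by move=> *; rewrite scalerA.
- by move=> *; rewrite scalerDl.
- by move=> *; rewrite scalerDr.
- by [].
- by [].
- by move=> *; exact: actD.
- by [].
- by move=> *; rewrite actZ.
Qed.

Let comp_homog m x : KP_comp m x -> homog m (repr x).
Proof.
have key t n : homog n t -> homog n (repr (\pi_KPalg t)).
  by move=> ht f i; rewrite (act_KPeq (KPalg_reprK t)) reprK ht.
elim=> {m x}.
- by move=> g; apply: key.
- by move=> n; apply: (key Kzero).
- move=> n x y _ hx _ hy; rewrite -[x]reprK -[y]reprK KP_addE.
  by apply: key; exact: homogD.
- move=> n a x _ hx; rewrite -[x]reprK KP_scaleE.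
  by apply: key; exact: homogZ.
- move=> m n x y _ hx _ hy; rewrite -[x]reprK -[y]reprK KP_mulE.
  by apply: key; exact: homogM.
Qed.

Lemma KP_comp_sub n x y : KP_comp n x -> KP_comp n y -> KP_comp n (x - y).
Proof.
by move=> hx hy; rewrite -scaleN1r; apply: KP_comp_add => //;
   exact: KP_comp_scale.
Qed.

Lemma KP_dsum : is_dsum [set: KPalg] KP_comp.
Proof.
split.
  apply/seteqP; split=> // x _; elim/quotW: x.
  elim=> [g||t [l hl lE] u [l' hl' lE']|a t [l hl lE]
         |t [l hl lE] u [l' hl' lE']].
  - exists [:: (KPgen_deg g, KP_gen g)]; last by rewrite big_seq1.
    by move=> p; rewrite inE => /eqP ->; exact: KP_comp_gen.
  - by exists [::]; rewrite // big_nil.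
  - exists (l ++ l'); last by rewrite big_cat -KP_addE lE lE'.
    by move=> p; rewrite mem_cat => /orP[/hl|/hl'].
  - exists [seq (p.1, a *: p.2) | p <- l].
      by move=> p /mapP[q /hl hq ->]; exact: KP_comp_scale.
    by rewrite big_map -KP_scaleE lE scaler_sumr.
  - exists [seq (p.1 + q.1, KP_mul p.2 q.2) | p <- l, q <- l'].
      move=> p /allpairsP[[q q'] [/hl hq /hl' hq' ->]] /=.
      exact: KP_comp_mul.
    rewrite big_allpairs_dep -KP_mulE lE lE' /=.
    rewrite (big_morph (KP_mul^~ _) (fun x y => KP_mulDl x y _) (mul0x _)).
    apply: eq_bigr => q _ /=.
    exact: (big_morph (KP_mul _) (fun x y => KP_mulDr _ x y) (mulx0 _)).
move=> s f us hf sf0 n ns.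
pose e (m : 'rV[int]_k) : U := if m == 0 then (1, 0) else 0.
have lmul_e x m : lmul x (e m) = (0, if m == 0 then x else 0).
  rewrite /e; case: ifP => _; congr pair.
    by rewrite /= scale1r mulx0 addr0.
  by rewrite /= scale0r mulx0 addr0.
pose t := \big[@Kadd K k L/Kzero]_(m <- s) repr (f m).
have tE : \pi_KPalg t = 0.
  rewrite -sf0 /t (big_morph \pi_KPalg (fun t u => esym (KP_addE t u)) erefl).
  by apply: eq_bigr => m _; rewrite reprK.
have act0 : KP_act t e n = 0.
  by rewrite (act_KPeq (u := Kzero)) //; apply/KPalg_eqP; rewrite tE.
have : (KP_act t e n).2 = f n.
  rewrite (big_morph (fun t => (KP_act t e n).2) (id1 := 0) (op1 := +%R)) //.
  rewrite (bigD1_seq n) //= [X in _ + X]big1_seq ?addr0.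
    by rewrite (comp_homog (hf _ ns)) lmul_e subrr eqxx reprK.
  move=> m /andP[mn ms].
  by rewrite (comp_homog (hf _ ms)) lmul_e subr_eq0 eq_sym (negPf mn).
by rewrite act0.
Qed.

Definition KP : gradedRing 'rV[int]_k :=
  GradedRing KP_mulA KP_mulDl KP_mulDr KP_comp_zero KP_comp_sub KP_comp_mul
    KP_dsum.

End KPalgebra.

(* Main.v *)
Require Import Defs.
From mathcomp Require Import all_boot all_order all_algebra finmap.
From mathcomp Require Import boolp classical_sets cardinality.
From mathcomp Require Import topology_structure connected.

(* Order ideals of T_L correspond to the hereditary saturated sets H of
   vertices, those with v in H iff s(a) in H for all a in vL^m. For a graded
   ideal I, the vertices v with p_v in I form such a set. Every homogeneous
   element of KP(L) is, for suitable m and n, a combination of elements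
   s_a s_b^* with a and b of degrees m and n. It follows that p_v KP(L) p_w = 0
   for v and w in disjoint hereditary sets, and that p_v in I + J puts every
   s(a), a in vL^m, in the vertex set of I or of J when m is large, so that v
   lies in every saturated set containing both. Since p_v is a nonzero
   idempotent, a graded ideal which does not contain it is contained in a graded
   prime which does not contain it either. So the partitions of the spectrum
   into two nonempty closed sets correspond to the decompositions of T_L. *)

Set Implicit Arguments.
Unset Strict Implicit.
Unset Printing Implicit Defensive.

Import GRing.Theory.

(** * Order ideals of the talented monoid and sets of vertices *)

Section KGraph.
Local Open Scope classical_set_scope.
Local Open Scope ring_scope.
Variables (k : nat) (L : kgraph k).
Implicit Types (a b c : mor L) (v : vert L) (m : 'rV[nat]_k) (H : set (vert L)).

Lemma nat_rV_addrI m : injective (+%R m).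
Proof.
move=> n n' /rowP mn; apply/rowP => i; have := mn i; rewrite !mxE.
exact: addnI.
Qed.

(** Cancellation in N^k gives [b] and [b'] the same degree, and unique factorization applies to the
    two pairs. *)
Lemma mcomp_inj a b a' b' : src a = rng b -> src a' = rng b' ->
  deg a = deg a' -> mcomp a b = mcomp a' b' -> a = a' /\ b = b'.
Proof.
move=> ab ab' dd cc; have dc := deg_comp ab.
have db : deg b = deg b'.
  apply: (@nat_rV_addrI (deg a)); rewrite -dc cc (deg_comp ab') dd.
  by [].
have [[x y] [_ u]] := factorization dc.
have := u (a, b); have := u (a', b').
move=> /(_ (And4 ab' (esym dd) (esym db) cc)) ->.
by move=> /(_ (And4 ab erefl erefl erefl)) [-> ->].
Qed.

(** The products of [a] with its two identities are two factorizations of [a] into factors of degree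
    0. *)
Lemma deg0_idm a : deg a = 0 -> a = idm (rng a).
Proof.
move=> a0.
have ab : src a = rng (idm (src a)) by rewrite rng_idm.
have ab' : src (idm (rng a)) = rng a by rewrite src_idm.
have [//||//] := mcomp_inj ab ab'; first by rewrite a0 deg_idm.
by rewrite comp_idl comp_idr.
Qed.

Lemma mor_factor a m n : deg a = m + n -> exists b c,
  [/\ src b = rng c, deg b = m, deg c = n & a = mcomp b c].
Proof. by move=> /factorization[[b c] [/= [bc <- <- ->]] _]; exists b, c. Qed.

(** Left to right is heredity, right to left saturation. The equivalence has the shape of the
    defining relations of T_L. *)
Definition hereditary_saturated H :=
  forall v m, H v <-> forall a, paths v m a -> H (src a).

(** The index of a generator is ignored because order ideals are closed under the action of Z^k. *)
Fixpoint Tall H (t : Tterm L) : Prop :=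
  match t with
  | Tgen v _ => H v
  | Tzero => True
  | Tadd t u => Tall H t /\ Tall H u
  end.

Lemma Tall_bigP H (s : seq (mor L)) (n : 'rV[int]_k) :
  Tall H (\big[@Tadd k L/Tzero]_(a <- s) Tgen (src a) n) <->
  forall a, a \in s -> H (src a).
Proof.
elim: s => [|a s IH]; first by rewrite big_nil.
rewrite big_cons /= IH; split=> [[Ha Hs] b|Hs].
  by rewrite inE => /predU1P[->|/Hs].
by split=> [|b bs]; apply: Hs; rewrite inE ?eqxx ?bs ?orbT.
Qed.

Lemma Tall_shift H q t : Tall H (Tshift q t) <-> Tall H t.
Proof. by elim: t => //= t [IHt IHt1] u [IHu IHu1]; split=> -[]; auto. Qed.

Section RowFinite.
Hypothesis L_rf : row_finite L.

Lemma Tall_eq H t u : hereditary_saturated H ->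
  Teq t u -> Tall H t <-> Tall H u.
Proof.
move=> hsH; elim=> {t u} /=; try tauto.
(* This is the case of the defining relations; row-finiteness makes [fset_set] list exactly the
   paths. *)
move=> v n m; rewrite Tall_bigP (hsH v m).
by split=> HH a; have := HH a; rewrite in_fset_set ?inE.
Qed.

Definition Tideal H : set (talented L) := [set x | Tall H (repr x)].

Lemma TidealE H t : hereditary_saturated H ->
  Tideal H (\pi_(talented L)%qT t) <-> Tall H t.
Proof. by move=> hsH; apply: Tall_eq => //; exact: talented_reprK. Qed.

Lemma talented_piD t u :
  \pi_(talented L)%qT (Tadd t u) =
  \pi_(talented L)%qT t + \pi_(talented L)%qT u.
Proof. by rewrite -talented_addE. Qed.

Lemma Zk_order_ideal_Tideal H :
  hereditary_saturated H -> Zk_order_ideal (Tideal H).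
Proof.
move=> hsH; have TD x y : Tideal H (x + y) <-> Tideal H x /\ Tideal H y.
  by rewrite -[x]reprK -[y]reprK -talented_piD !TidealE.
split.
- exact/(TidealE Tzero).
- by move=> x y Hx Hy; apply/TD.
- by move=> x y [z ->] /TD[].
- by move=> q x Hx; apply/TidealE/Tall_shift.
Qed.

Definition Tvert (J : set (talented L)) : set (vert L) :=
  [set v | J (tgen v 0)].

Section OrderIdeal.
Variable J : set (talented L).
Hypothesis idJ : Zk_order_ideal J.

Lemma order_idealD x y : J (x + y) <-> J x /\ J y.
Proof.
have [_ JD Jle _] := idJ; split=> [Jxy|[]]; last exact: JD.
by split; apply: Jle Jxy; [exists y|exists x; rewrite addrC].
Qed.

Lemma order_ideal_gen v n : J (tgen v n) <-> Tvert J v.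
Proof.
have [_ _ _ Jq] := idJ; split=> Jv.
  by have := Jq (- n) _ Jv; rewrite tshift_gen subrr.
by have := Jq n _ Jv; rewrite tshift_gen add0r.
Qed.

(** A sum lies in [J] exactly when its summands do, so [J] is determined by the vertices it
    contains. *)
Lemma order_idealP t : J (\pi_(talented L)%qT t) <-> Tall (Tvert J) t.
Proof.
elim: t => [v n||t IHt u IHu] /=.
- exact: order_ideal_gen.
- by split=> // _; case: idJ.
- by rewrite talented_piD order_idealD IHt IHu.
Qed.

Lemma hereditary_saturated_Tvert : hereditary_saturated (Tvert J).
Proof.
move=> v m; have /talented_eqP E := Teq_rel v 0 m.
rewrite [X in X <-> _](_ : _ = J (\pi_(talented L)%qT (Tgen v 0))) // E.
rewrite order_idealP Tall_bigP.
by split=> HH a; have := HH a; rewrite in_fset_set ?inE.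
Qed.

Lemma Tideal_Tvert : Tideal (Tvert J) = J.
Proof.
by apply/seteqP; split=> x; have := order_idealP (repr x); rewrite reprK => -[].
Qed.

End OrderIdeal.

Lemma Tvert_Tideal H : hereditary_saturated H -> Tvert (Tideal H) = H.
Proof.
by move=> hsH; apply/seteqP; split=> v; have [] := TidealE (Tgen v 0) hsH.
Qed.

Lemma Tideal_setT : Tideal setT = setT.
Proof. by apply/seteqP; split=> // x _; rewrite /Tideal /=; elim: (repr x). Qed.

Lemma Tideal_subset H H' : H `<=` H' -> Tideal H `<=` Tideal H'.
Proof.
move=> HH x; rewrite /Tideal /=.
by elim: (repr x) => [v n /HH||t IHt u IHu [/IHt ? /IHu ?]].
Qed.

(** A term with all its generators in both sets has no generators, so it is a sum of zeros. *)
Lemma Tideal_set0I H H' : hereditary_saturated H -> hereditary_saturated H' ->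
  H `&` H' = set0 -> Tideal H `&` Tideal H' = [set 0].
Proof.
move=> hsH hsH' HH'; apply/seteqP; split=> x /=; last first.
  by move=> ->; split; apply/(TidealE Tzero).
rewrite -[x]reprK !TidealE //; elim: (repr x) => [v n|//|t IHt u IHu] /=.
  by move=> vHH; have : (H `&` H') v by []; rewrite HH'.
by move=> [[tH uH] [tH' uH']]; rewrite talented_piD IHt // IHu // addr0.
Qed.

Hypothesis L_ns : no_sources L.

Lemma hereditary_saturated0 : hereditary_saturated set0.
Proof.
by move=> v m; split=> // H0; have [a /H0] := L_ns v m.
Qed.

(** The empty set, saturated because there are no sources, separates the two: [Tall set0] holds of
    [Tzero] and of no generator. *)
Lemma tgen_neq0 v n : tgen v n <> 0 :> talented L.
Proof.
move=> /talented_eqP /(Tall_eq hereditary_saturated0) /= [_ H].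
exact: H.
Qed.

(** [Tvert] and [Tideal] are mutually inverse and preserve inclusions. Intersection 0 becomes empty
    intersection, since a common vertex would give a nonzero common element. *)
Lemma decomposable_vertP : decomposable L <-> exists H1 H2,
  [/\ hereditary_saturated H1 /\ H1 <> setT,
      hereditary_saturated H2 /\ H2 <> setT, H1 `&` H2 = set0
    & forall H, hereditary_saturated H -> H1 `<=` H -> H2 `<=` H -> H = setT].
Proof.
split=> [[J1 [J2 [[id1 n1] [id2 n2] J12 gen]]]|].
  exists (Tvert J1), (Tvert J2); split.
  - split; first exact: hereditary_saturated_Tvert.
    by move=> E; apply: n1; rewrite -(Tideal_Tvert id1) E Tideal_setT.
  - split; first exact: hereditary_saturated_Tvert.
    by move=> E; apply: n2; rewrite -(Tideal_Tvert id2) E Tideal_setT.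
  - apply/seteqP; split=> // v [v1 v2].
    have : (J1 `&` J2) (tgen v 0) by [].
    by rewrite J12 => /tgen_neq0.
  - move=> H hsH H1 H2; have JT : Tideal H = setT.
      apply/seteqP; split=> // x _.
      have : smallest (@Zk_order_ideal k L) (J1 `|` J2) x by rewrite gen.
      apply; split; first exact: Zk_order_ideal_Tideal.
      rewrite -(Tideal_Tvert id1) -(Tideal_Tvert id2).
      by move=> y [|]; exact: Tideal_subset.
    by rewrite -(Tvert_Tideal hsH) JT.
move=> [H1 [H2 [[hs1 n1] [hs2 n2] H12 gen]]].
exists (Tideal H1), (Tideal H2); split.
- split; first exact: Zk_order_ideal_Tideal.
  by move=> E; apply: n1; rewrite -(Tvert_Tideal hs1) E.
- split; first exact: Zk_order_ideal_Tideal.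
  by move=> E; apply: n2; rewrite -(Tvert_Tideal hs2) E.
- exact: Tideal_set0I.
- apply/seteqP; split=> // x _ J [idJ J12].
  rewrite -(Tideal_Tvert idJ) (gen _ (hereditary_saturated_Tvert idJ)).
  + by rewrite Tideal_setT.
  + by rewrite -(Tvert_Tideal hs1) => v v1; apply: J12; left.
  + by rewrite -(Tvert_Tideal hs2) => v v2; apply: J12; right.
Qed.

End RowFinite.
End KGraph.

(** * The vertex idempotents are nonzero *)

Section Representation.
Local Open Scope classical_set_scope.
Local Open Scope ring_scope.
Variables (K : fieldType) (k : nat) (L : kgraph k).
Implicit Types (a b c l : mor L) (v : vert L) (m n D N : 'rV[nat]_k).
Implicit Types (t u w : KPterm K L) (f g : mor L -> K).

(** The cofactor is unique by [mcomp_inj], so the choice made by [cid] does not matter. *)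
Definition left_factor a l : option (mor L) :=
  if pselect (exists b, src a = rng b /\ l = mcomp a b) is left h
  then Some (projT1 (cid h)) else None.

Lemma left_factorE a b : src a = rng b -> left_factor a (mcomp a b) = Some b.
Proof.
move=> ab; rewrite /left_factor; case: pselect => [h|[]]; last by exists b.
by case: (cid h) => b' [ab' /= E]; have [_ <-] := mcomp_inj ab ab' erefl E.
Qed.

Variant left_factor_spec a l : option (mor L) -> Prop :=
| LeftFactor b of src a = rng b & l = mcomp a b : left_factor_spec a l (Some b)
| NoLeftFactor of (forall b, src a = rng b -> l <> mcomp a b) :
    left_factor_spec a l None.

Lemma left_factorP a l : left_factor_spec a l (left_factor a l).
Proof.
rewrite /left_factor; case: pselect => [h|h].
  by case: (cid h) => b [ab lE]; constructor.
by constructor => b ab lE; apply: h; exists b.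
Qed.

(* The Toeplitz representation on the functions on L. The defining relations of
   KP(L) hold in it only at the morphisms of large degree: [p_v] differs from
   [\sum_a s_a s_a^*], a of degree n, at the morphisms which have no factor of
   degree n. *)
Fixpoint toeplitz t f l : K :=
  match t with
  | Kgen (KPp v) => if rng l == v then f l else 0
  | Kgen (KPs a) => if left_factor (val a) l is Some b then f b else 0
  | Kgen (KPg a) => if src (val a) == rng l then f (mcomp (val a) l) else 0
  | Kzero => 0
  | Kadd t u => toeplitz t f l + toeplitz u f l
  | Kscale x t => x * toeplitz t f l
  | Kmul t u => toeplitz t (toeplitz u f) l
  end.

(** The equation [deg l = N + m] says that [deg l] dominates [N] in every coordinate. *)
Definition agree_from N f g := forall l m, deg l = N + m -> f l = g l.

Lemma agree_fromD N D f g : agree_from N f g -> agree_from (N + D) f g.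
Proof. by move=> fg l m lE; apply: (fg l (D + m)); rewrite lE addrA. Qed.

Lemma toeplitzD t f g l :
  toeplitz t (fun l => f l + g l) l = toeplitz t f l + toeplitz t g l.
Proof.
elim: t f g l => [[v|a|a]||t IHt u IHu|x t IHt|t IHt u IHu] f g l /=.
- by case: ifP; rewrite ?addr0.
- by case: left_factor => //; rewrite addr0.
- by case: ifP; rewrite ?addr0.
- by rewrite addr0.
- by rewrite IHt IHu addrACA.
- by rewrite IHt mulrDr.
- by rewrite -IHt; congr toeplitz; apply/funext => l'; rewrite IHu.
Qed.

Lemma toeplitzZ t x f l : toeplitz t (fun l => x * f l) l = x * toeplitz t f l.
Proof.
elim: t x f l => [[v|a|a]||t IHt u IHu|y t IHt|t IHt u IHu] x f l /=.
- by case: ifP; rewrite ?mulr0.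
- by case: left_factor => //; rewrite mulr0.
- by case: ifP; rewrite ?mulr0.
- by rewrite mulr0.
- by rewrite IHt IHu mulrDr.
- by rewrite IHt mulrCA.
- by rewrite -IHt; congr toeplitz; apply/funext => l'; rewrite IHu.
Qed.

(** Only the operator of s_a reads its argument at shorter morphisms, shorter by the degree of [a];
    [D] bounds the total loss over the term. *)
Lemma toeplitz_local t : exists D, forall N f g,
  agree_from N f g -> agree_from (N + D) (toeplitz t f) (toeplitz t g).
Proof.
elim: t => [[v|a|a]||t [D HD] u [D' HD']|x t [D HD]|t [D HD] u [D' HD']] /=.
- exists 0 => N f g fg l m lE /=; case: ifP => // _.
  exact: (agree_fromD fg) lE.
- exists (deg (val a)) => N f g fg l m lE /=; case: left_factorP => // b ab lab.
  apply: (fg b m); apply: (@nat_rV_addrI _ (deg (val a))).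
  by rewrite -deg_comp // -lab lE addrA [_ + N]addrC.
- exists 0 => N f g fg l m lE /=; case: eqP => // al.
  apply: (fg _ (deg (val a) + m)).
  by rewrite deg_comp // lE addr0 addrCA.
- by exists 0.
- exists (D + D') => N f g fg l m lE /=; congr (_ + _).
    by apply: (agree_fromD (D := D') (HD _ _ _ fg)) (m) _; rewrite lE addrA.
  apply: (agree_fromD (D := D) (HD' _ _ _ fg)) (m) _.
  by rewrite lE [D + D']addrC addrA.
- by exists D => N f g /HD fg l m /fg /= ->.
- exists (D + D') => N f g /HD' /HD fg; rewrite [D + D']addrC addrA.
  exact: fg.
Qed.

Hypothesis L_rf : row_finite L.

Lemma npaths_finite v n : finite_set (npaths v n).
Proof.
by apply: (@finite_preimage _ _ (paths v n) val) => // a b _ _; exact: val_inj.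
Qed.

Lemma in_npaths v n (a : npath L) :
  (a \in fset_set (npaths v n)) = `[< paths v n (val a) >].
Proof.
rewrite in_fset_set; last exact: npaths_finite.
by apply/idP/asboolP => [/set_mem|/mem_set].
Qed.

Lemma toeplitz_rel t u : KPrel t u ->
  exists N, forall f, agree_from N (toeplitz t f) (toeplitz u f).
Proof.
case=> {t u}.
- move=> v w; exists 0 => f l m _ /=.
  case: (eqVneq v w) => [->|vw] /=; first by case: ifP => // ->.
  by case: eqP => // ->; rewrite (negPf vw).
- move=> a b c ab cE; exists 0 => f l m _ /=; rewrite cE.
  have rc := rng_comp ab; have sc := src_comp ab.
  case: (left_factorP (val a)) => [l' al' ->|H].
    case: (left_factorP (val b)) => [l'' bl'' ->|H].
      by rewrite Defs.compA // left_factorE // sc.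
    case: left_factorP => // l'' cl''; rewrite sc in cl''.
    rewrite -Defs.compA // => /(mcomp_inj al'); rewrite rng_comp // => -[] // _.
    by move/H; case.
  case: left_factorP => // l'' cl''; rewrite sc in cl''.
  by rewrite -Defs.compA // => /H; rewrite rng_comp // => /(_ ab).
- move=> a b c ab cE; exists 0 => f l m _ /=; rewrite cE src_comp //.
  by case: eqP => // bl; rewrite rng_comp // ab eqxx Defs.compA.
- move=> a; exists 0 => f l m _ /=.
  by case: left_factorP => [b ab ->|]; [rewrite rng_comp // eqxx|case: ifP].
- move=> a; exists 0 => f l m _ /=.
  by case: left_factorP => // b ->; rewrite eqxx.
- move=> a; exists 0 => f l m _ /=.
  by rewrite eq_sym; case: eqP.
- move=> a; exists 0 => f l m _ /=.
  by case: eqP => // al; rewrite rng_comp // eqxx.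
- move=> a b ab; exists 0 => f l m _ /=.
  case: (eqVneq a b) => [->|nab] /=.
    by rewrite [RHS]/= eq_sym; case: eqP => // bl; rewrite left_factorE.
  case: eqP => // al; case: left_factorP => // l' bl'.
  by case/(mcomp_inj al bl' ab) => /val_inj /eqP; rewrite (negPf nab).
(* The threshold is [n]: such an [l] has exactly one initial factor [b] of degree [n], and only the
   summand of [b] can be nonzero at [l]. *)
- move=> v n n0; exists n => f l m lE.
  have [b [l' [bl' bn _ lE']]] := mor_factor lE.
  have nb : deg b != 0 by rewrite bn.
  pose b' : npath L := exist _ b nb.
  rewrite (big_morph (fun t => toeplitz t f l) (id1 := 0) (op1 := +%R)) //=.
  have E (a : npath L) : a \in fset_set (npaths v n) -> a != b' ->
    toeplitz (Kmul (Kgen (KPs a)) (Kgen (KPg a))) f l = 0.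
    rewrite in_npaths => /asboolP[an av] ab /=.
    case: left_factorP => // c ac; rewrite lE' => /esym /(mcomp_inj ac bl').
    rewrite an bn => /(_ erefl) [abE _].
    by case/eqP: ab; apply: val_inj.
  have [vb|vb] := eqVneq (rng l) v.
    rewrite (bigD1_seq b') /= ?fset_uniq //; last first.
      rewrite in_npaths; apply/asboolP; split=> //=.
      by rewrite -vb lE' rng_comp.
    rewrite big_seq_cond big1 ?addr0; last by move=> a /andP[]; exact: E.
    by rewrite lE' left_factorE // bl' eqxx.
  rewrite big_seq big1 // => a aP; apply: E => //.
  move: aP; rewrite in_npaths => /asboolP[an av].
  apply: contra_neq vb => ab; rewrite -av ab lE' rng_comp //.
Qed.

Lemma toeplitz_eq t u : KPeq t u ->
  exists N, forall f, agree_from N (toeplitz t f) (toeplitz u f).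
Proof.
elim=> {t u}.
- exact: toeplitz_rel.
- by exists 0.
- by move=> t u _ [N H]; exists N => f l m /H ->.
- move=> t u w _ [N H] _ [N' H']; exists (N + N') => f l m lE.
  rewrite (agree_fromD (H f) lE); apply: (H' f l (N + m)).
  by rewrite lE addrA [N' + N]addrC.
- move=> t t' u u' _ [N H] _ [N' H']; exists (N + N') => f l m lE /=.
  rewrite (agree_fromD (H f) lE); congr (_ + _); apply: (H' f l (N + m)).
  by rewrite lE addrA [N' + N]addrC.
- by move=> x t t' _ [N H]; exists N => f l m /H /= ->.
(* Exchanging [u] for [u'] under [t] moves the threshold [N'] up by the locality bound [D] of
   [t]. *)
- move=> t t' u u' _ [N H] _ [N' H']; have [D HD] := toeplitz_local t.
  exists (N + (N' + D)) => f l m lE /=.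
  rewrite -(agree_fromD (H _) lE).
  apply: (HD _ _ _ (H' f) l (N + m)).
  by rewrite lE [N + _]addrC -addrA.
- by exists 0 => f l m _ /=; rewrite addrA.
- by exists 0 => f l m _ /=; rewrite addrC.
- by exists 0 => f l m _ /=; rewrite add0r.
- by exists 0 => f l m _ /=; rewrite mul0r.
- by exists 0 => f l m _ /=; rewrite mul1r.
- by exists 0 => f l m _ /=; rewrite mulrA.
- by exists 0 => f l m _ /=; rewrite mulrDl.
- by exists 0 => f l m _ /=; rewrite mulrDr.
- by exists 0.
- by exists 0.
- by exists 0 => f l m _ /=; rewrite toeplitzD.
- by exists 0.
- by exists 0 => f l m _ /=; rewrite toeplitzZ.
Qed.

Hypothesis L_ns : no_sources L.

(** The operator of p_v keeps the value of the constant function 1 at a morphism with range [v], and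
    without sources there is such a morphism past any threshold. *)
Lemma KP_vertex_neq0 v : KP_gen K (KPp v) <> 0.
Proof.
move=> /KPalg_eqP /toeplitz_eq[N H]; have [l [lN lv]] := L_ns v N.
have := H (fun=> 1) l 0; rewrite addr0 /= lv eqxx => /(_ lN) /eqP.
by rewrite oner_eq0.
Qed.

End Representation.

(** * Spanning elements and homogeneous components of KP(L) *)

Section KPStructure.
Local Open Scope classical_set_scope.
Local Open Scope ring_scope.
Variables (K : fieldType) (k : nat) (L : kgraph k).
Implicit Types (a b c : mor L) (v : vert L) (m n : 'rV[nat]_k).
Implicit Types (x y z : KPalg K L).
Local Notation "x ** y" := (KP_mul x y) (at level 40, left associativity).

Lemma KP_mul0x x : 0 ** x = 0.
Proof. by apply: (addrI (0 ** x)); rewrite -KP_mulDl !addr0. Qed.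

Lemma KP_mulx0 x : x ** 0 = 0.
Proof. by apply: (addrI (x ** 0)); rewrite -KP_mulDr !addr0. Qed.

Lemma KP_mul_suml T (s : seq T) (F : T -> KPalg K L) x :
  (\sum_(i <- s) F i) ** x = \sum_(i <- s) F i ** x.
Proof.
by elim/big_ind2: _ => [|y1 y2 z1 z2 <- <-|//]; rewrite ?KP_mul0x ?KP_mulDl.
Qed.

Lemma KP_mul_sumr T (s : seq T) (F : T -> KPalg K L) x :
  x ** (\sum_(i <- s) F i) = \sum_(i <- s) x ** F i.
Proof.
by elim/big_ind2: _ => [|y1 y2 z1 z2 <- <-|//]; rewrite ?KP_mulx0 ?KP_mulDr.
Qed.

Definition KPvert v : KPalg K L := KP_gen K (KPp v).

(* With the convention of the paper that [s_v = s_v^* = p_v]. *)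
Definition KPpath a : KPalg K L :=
  if insub a is Some b then KP_gen K (KPs b) else KPvert (rng a).
Definition KPghost a : KPalg K L :=
  if insub a is Some b then KP_gen K (KPg b) else KPvert (rng a).

Variant path_spec a : KPalg K L -> KPalg K L -> Type :=
| PathVertex v of a = idm v : path_spec a (KPvert v) (KPvert v)
| PathEdge (b : npath L) of a = val b :
    path_spec a (KP_gen K (KPs b)) (KP_gen K (KPg b)).

Lemma pathP a : path_spec a (KPpath a) (KPghost a).
Proof.
rewrite /KPpath /KPghost; case: insubP => [b _ <-|]; first exact: PathEdge.
by rewrite negbK => /eqP /deg0_idm; exact: PathVertex.
Qed.

Lemma KPpath_idm v : KPpath (idm v) = KPvert v.
Proof. by rewrite /KPpath insubN ?rng_idm // deg_idm eqxx. Qed.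

Lemma KPghost_idm v : KPghost (idm v) = KPvert v.
Proof. by rewrite /KPghost insubN ?rng_idm // deg_idm eqxx. Qed.

Lemma KPpath_val (b : npath L) : KPpath (val b) = KP_gen K (KPs b).
Proof. by rewrite /KPpath valK. Qed.

Lemma KPghost_val (b : npath L) : KPghost (val b) = KP_gen K (KPg b).
Proof. by rewrite /KPghost valK. Qed.

Lemma KPrel_eq t u : KPrel t u -> \pi_(KPalg K L)%qT t = \pi_(KPalg K L)%qT u.
Proof. by move=> tu; apply/KPalg_eqP/KPeq_rel. Qed.

Lemma KPvertM v w : KPvert v ** KPvert w = if v == w then KPvert v else 0.
Proof. by rewrite [LHS]KP_mulE (KPrel_eq (KPrel_pp _ _ _)); case: ifP. Qed.

Lemma KPvert_idem v : KPvert v ** KPvert v = KPvert v.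
Proof. by rewrite KPvertM eqxx. Qed.

Lemma KPvert_path a : KPvert (rng a) ** KPpath a = KPpath a.
Proof.
case: pathP => [v ->|b ->]; first by rewrite rng_idm KPvert_idem.
by rewrite [LHS]KP_mulE (KPrel_eq (KPrel_ps _ _)).
Qed.

Lemma KPpath_vert a : KPpath a ** KPvert (src a) = KPpath a.
Proof.
case: pathP => [v ->|b ->]; first by rewrite src_idm KPvert_idem.
by rewrite [LHS]KP_mulE (KPrel_eq (KPrel_sp _ _)).
Qed.

Lemma KPvert_ghost a : KPvert (src a) ** KPghost a = KPghost a.
Proof.
case: pathP => [v ->|b ->]; first by rewrite src_idm KPvert_idem.
by rewrite [LHS]KP_mulE (KPrel_eq (KPrel_pg _ _)).
Qed.

Lemma KPghost_vert a : KPghost a ** KPvert (rng a) = KPghost a.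
Proof.
case: pathP => [v ->|b ->]; first by rewrite rng_idm KPvert_idem.
by rewrite [LHS]KP_mulE (KPrel_eq (KPrel_gp _ _)).
Qed.

Lemma npath_comp (a b : npath L) : src (val a) = rng (val b) ->
  exists c : npath L, val c = mcomp (val a) (val b).
Proof.
move=> ab; suff c0 : deg (mcomp (val a) (val b)) != 0.
  by exists (exist (fun c => deg c != 0) _ c0).
rewrite deg_comp //; apply: contra (valP a) => /eqP /rowP E.
apply/eqP/rowP => i; have := E i; rewrite !mxE => /eqP.
by rewrite addn_eq0 => /andP[/eqP].
Qed.

Lemma KPpathM a b : src a = rng b -> KPpath a ** KPpath b = KPpath (mcomp a b).
Proof.
case: (pathP a) => [v ->|a' ->].
  by rewrite src_idm => ->; rewrite KPvert_path comp_idl.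
case: (pathP b) => [v ->|b' ->].
  rewrite rng_idm => <-.
  by rewrite comp_idr KPpath_val -KPpath_val KPpath_vert.
move=> ab; have [c cE] := npath_comp ab.
by rewrite [LHS]KP_mulE (KPrel_eq (KPrel_ss _ ab cE)) -cE KPpath_val.
Qed.

Lemma KPghostM a b : src a = rng b ->
  KPghost b ** KPghost a = KPghost (mcomp a b).
Proof.
case: (pathP a) => [v ->|a' ->].
  by rewrite src_idm => ->; rewrite KPghost_vert comp_idl.
case: (pathP b) => [v ->|b' ->].
  rewrite rng_idm => <-.
  by rewrite comp_idr KPghost_val -KPghost_val KPvert_ghost.
move=> ab; have [c cE] := npath_comp ab.
by rewrite [LHS]KP_mulE (KPrel_eq (KPrel_gg _ ab cE)) -cE KPghost_val.
Qed.

Lemma KPghost_path a b : deg a = deg b ->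
  KPghost a ** KPpath b = if a == b then KPvert (src a) else 0.
Proof.
case: (pathP a) => [v ->|a' ->].
  rewrite deg_idm => /esym /deg0_idm bE; rewrite bE KPpath_idm src_idm KPvertM.
  by rewrite (can_eq (@rng_idm _ L)).
case: (pathP b) => [v ->|b' ->].
  by rewrite deg_idm => /eqP; rewrite (negPf (valP a')).
move=> ab; rewrite [LHS]KP_mulE (KPrel_eq (KPrel_gs _ ab)) val_eqE.
by case: ifP.
Qed.

(** With both degrees fixed, these elements multiply like matrix units: s_b^* s_c is p_{s(b)} or 0
    when [b] and [c] have the same degree. *)
Inductive KPspan m n : KPalg K L -> Prop :=
| KPspan0 : KPspan m n 0
| KPspan_cons (x : K) a b y : deg a = m -> deg b = n -> src a = src b ->
    KPspan m n y -> KPspan m n (x *: (KPpath a ** KPghost b) + y).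

Lemma KPspan_path a b : src a = src b ->
  KPspan (deg a) (deg b) (KPpath a ** KPghost b).
Proof.
move=> ab; rewrite -[_ ** _]addr0 -[_ ** _]scale1r.
by apply: KPspan_cons => //; exact: KPspan0.
Qed.

Lemma KPspanD m n x y : KPspan m n x -> KPspan m n y -> KPspan m n (x + y).
Proof.
elim=> [|c a b z am bn ab _ IH]; rewrite ?add0r // => /IH.
by rewrite -addrA; exact: KPspan_cons.
Qed.

Lemma KPspanZ m n (c : K) x : KPspan m n x -> KPspan m n (c *: x).
Proof.
elim=> [|d a b z am bn ab _ IH]; first by rewrite scaler0; exact: KPspan0.
by rewrite scalerDr scalerA; exact: KPspan_cons.
Qed.

Lemma KPspan_sum m n (T : eqType) (s : seq T) (F : T -> KPalg K L) :
  (forall i, i \in s -> KPspan m n (F i)) -> KPspan m n (\sum_(i <- s) F i).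
Proof.
move=> H; rewrite big_seq; apply: (big_ind (KPspan m n)) => //.
- exact: KPspan0.
- exact: KPspanD.
Qed.

(** Compression by s_a^* and s_b kills every spanning term other than s_a s_b^*, so [c] collects the
    coefficients of that term. *)
Lemma KPspan_coef m n x a b : KPspan m n x -> deg a = m -> deg b = n ->
  exists c : K, KPghost a ** x ** KPpath b = c *: KPvert (src a).
Proof.
move=> Hx am bn; elim: Hx => [|c a' b' y am' bn' ab' _ [d IH]].
  by exists 0; rewrite KP_mulx0 KP_mul0x scale0r.
rewrite KP_mulDr KP_mulDl IH -KP_scaleAr -KP_scaleAl.
suff [e ->] : exists e : K,
    KPghost a ** (KPpath a' ** KPghost b') ** KPpath b = e *: KPvert (src a).
  by exists (c * e + d); rewrite scalerA scalerDl.
rewrite KP_mulA KPghost_path ?am // -KP_mulA KPghost_path ?bn' //.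
case: eqP => [aa'|_]; last by exists 0; rewrite KP_mul0x scale0r.
case: eqP => [bb'|_]; last by exists 0; rewrite KP_mulx0 scale0r.
by exists 1; rewrite scale1r -ab' -aa' KPvert_idem.
Qed.

Hypothesis L_rf : row_finite L.

(** The presentation has this relation for nonzero [n]; for [n = 0] the identity is the only path
    and p_v p_v = p_v. *)
Lemma KPvert_sum v n : exists2 s : seq (mor L),
  (forall a, a \in s <-> paths v n a) &
  KPvert v = \sum_(a <- s) KPpath a ** KPghost a.
Proof.
have [->|n0] := eqVneq n 0.
  exists [:: idm v]; last first.
    by rewrite big_seq1 KPpath_idm KPghost_idm KPvert_idem.
  move=> a; rewrite inE; split=> [/eqP ->|[/deg0_idm aE av]].
    by split; [exact: deg_idm|exact: rng_idm].
  by rewrite aE av.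
exists [seq val e | e <- fset_set (npaths v n)].
  move=> a; split=> [/mapP[b + ->]|va].
    by rewrite in_npaths // => /asboolP.
  have a0 : deg a != 0 by case: va => ->.
  apply/mapP; exists (exist (fun c => deg c != 0) a a0) => //.
  by rewrite in_npaths //; apply/asboolP.
rewrite [LHS](KPrel_eq (KPrel_sum _ _ n0)) big_map.
rewrite (big_morph \pi_(KPalg K L)%qT (fun t u => esym (KP_addE t u)) erefl).
by apply: eq_bigr => a _; rewrite -KP_mulE KPpath_val KPghost_val.
Qed.

(** Writing p_{s(a)} between s_a and s_b^* as the sum of s_i s_i^* over the paths [i] of degree [l]
    lengthens both factors by [i]. *)
Lemma KPspan_raise m n l x : KPspan m n x -> KPspan (m + l) (n + l) x.
Proof.
elim=> [|c a b y <- <- ab _ IH]; first exact: KPspan0.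
apply: KPspanD => //; apply: KPspanZ; rewrite -KPpath_vert.
have [s sP ->] := KPvert_sum (src a) l.
rewrite KP_mul_sumr KP_mul_suml; apply: KPspan_sum => i /sP[<- ai].
rewrite KP_mulA KPpathM ?ai // -KP_mulA KPghostM; last by rewrite ai.
rewrite -!deg_comp ?ai //; apply: KPspan_path.
by rewrite !src_comp ?ai.
Qed.

Lemma KPspanM l m n x y : KPspan m l x -> KPspan l n y -> KPspan m n (x ** y).
Proof.
move=> Hx Hy; elim: Hx => [|c a b z am bn ab _ IH].
  by rewrite KP_mul0x; exact: KPspan0.
rewrite KP_mulDl; apply: KPspanD => //; rewrite -KP_scaleAl.
apply: KPspanZ => {IH}.
elim: Hy => [|d a' b' w am' bn' ab' _ IH].
  by rewrite KP_mulx0; exact: KPspan0.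
rewrite KP_mulDr; apply: KPspanD => //; rewrite -KP_scaleAr; apply: KPspanZ.
rewrite KP_mulA -[KPpath a ** _ ** _]KP_mulA KPghost_path ?bn //.
case: eqP => [ba'|_]; last by rewrite KP_mulx0 KP_mul0x; exact: KPspan0.
by rewrite -ab KPpath_vert -am -bn'; apply: KPspan_path; rewrite ab ba'.
Qed.

(** The hypothesis amounts to [n + m' = m + n'] in N^k, so raising by [m'] reaches the degrees
    obtained from [m'] and [n'] by raising by [m]. *)
Lemma KPspan_raise_eq m n m' n' x : toZ m - toZ n = toZ m' - toZ n' ->
  KPspan m n x -> KPspan (m + m') (m + n') x.
Proof.
move=> E /(KPspan_raise m'); rewrite (_ : n + m' = m + n') //.
apply/rowP => i; have /rowP /(_ i) := E; rewrite !mxE => /eqP.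
rewrite subr_eq addrAC eq_sym subr_eq -!PoszD => /eqP mn.
by rewrite addrC; case: mn.
Qed.

Lemma KP_compP q x : KP_comp q x ->
  exists m n, toZ m - toZ n = q /\ KPspan m n x.
Proof.
have toZ0 : toZ 0 = 0 :> 'rV[int]_k by apply/rowP => i; rewrite !mxE.
have KPspanv a : KPspan (deg a) 0 (KPpath a).
  rewrite -(deg_idm (src a)) -KPpath_vert -KPghost_idm; apply: KPspan_path.
  by rewrite src_idm.
have KPspanvg a : KPspan 0 (deg a) (KPghost a).
  rewrite -(deg_idm (src a)) -KPvert_ghost -KPpath_idm; apply: KPspan_path.
  by rewrite src_idm.
elim=> {q x} [g|q|q x y _ [m [n [E Hx]]] _ [m' [n' [E' Hy]]]
  |q c x _ [m [n [E Hx]]]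
  |q q' x y _ [m [n [<- Hx]]] _ [m' [n' [<- Hy]]]].
- case: g => [v|a|a] /=.
  + exists 0, 0; split; first by rewrite subrr.
    by have := KPspanv (idm v); rewrite KPpath_idm deg_idm.
  + exists (deg (val a)), 0; rewrite toZ0 subr0; split=> //.
    by rewrite -KPpath_val; exact: KPspanv.
  + exists 0, (deg (val a)); rewrite toZ0 sub0r; split=> //.
    by rewrite -KPghost_val; exact: KPspanvg.
(* Zero is homogeneous of every degree; the witnesses are the positive and negative parts of [q],
   where [Negz p] stands for -(p + 1). *)
- exists (map_mx (fun z : int => if z is Posz p then p else 0%N) q),
    (map_mx (fun z : int => if z is Negz p then p.+1 else 0%N) q).
  split; last exact: KPspan0.
  apply/rowP => i; rewrite !mxE.
  by case: (q 0 i) => p; rewrite ?subr0 // sub0r NegzE.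
- exists (m + m'), (m + n'); split.
    by rewrite !toZD [toZ m + toZ m']addrC addrKA.
  apply: KPspanD; first by apply: KPspan_raise_eq Hx; rewrite E E'.
  rewrite ![m + _]addrC; exact: KPspan_raise.
- by exists m, n; split=> //; exact: KPspanZ.
(* Both factors are raised until the inner degrees agree at [n + m']. *)
- exists (m + m'), (n + n'); split; first by rewrite !toZD opprD addrACA.
  apply: (@KPspanM (n + m')); first exact: KPspan_raise.
  by rewrite addrC [n + n']addrC; exact: KPspan_raise.
Qed.

(** Every element is a sum of homogeneous ones, which [KP_compP] writes as combinations of elements
    s_a s_b^*. *)
Lemma KP_ind (P : KPalg K L -> Prop) :
  P 0 -> (forall x y, P x -> P y -> P (x + y)) ->
  (forall (c : K) x, P x -> P (c *: x)) ->
  (forall a b, src a = src b -> P (KPpath a ** KPghost b)) -> forall x, P x.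
Proof.
move=> P0 PD PZ Pab x; have [dec _] := KP_dsum K L.
have : [set: KPalg K L] x by [].
rewrite dec => -[l Hl ->]; rewrite big_seq; apply: (big_ind P) => // p /Hl.
case/KP_compP => m [n [_]]; elim=> // c a b y _ _ ab _ IH.
by apply: PD => //; apply: PZ; exact: Pab.
Qed.

End KPStructure.

(** * Sums of graded ideals and existence of graded primes *)

Section GradedRing.
Local Open Scope classical_set_scope.
Local Open Scope ring_scope.
Variables (N : zmodType) (R : gradedRing N).
Implicit Types (I J A : set R) (x y e : R) (n : N).
Local Notation "x ** y" := (@gr_mul N R x y) (at level 40, left associativity).

Lemma ring_idealN I x : ring_ideal I -> I x -> I (- x).
Proof. by move=> [I0 IB _ _] Ix; rewrite -[- x]add0r; exact: IB. Qed.

Lemma ring_idealD I x y : ring_ideal I -> I x -> I y -> I (x + y).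
Proof.
move=> idI Ix Iy; rewrite -[y]opprK; have [_ IB _ _] := idI.
by apply: IB => //; exact: ring_idealN.
Qed.

Lemma gr_mul0x x : 0 ** x = 0.
Proof. by apply: (addrI (0 ** x)); rewrite -gr_mulDl !addr0. Qed.

Lemma gr_mulx0 x : x ** 0 = 0.
Proof. by apply: (addrI (x ** 0)); rewrite -gr_mulDr !addr0. Qed.

Lemma graded_ideal0 : graded_ideal [set 0 : R].
Proof.
apply: graded_idealP => [|x ->]; last by exists [::]; rewrite ?big_nil.
split=> // [x y -> ->|a x ->|a x ->]; rewrite ?subr0 //.
  exact: gr_mulx0.
exact: gr_mul0x.
Qed.

Lemma gr_comp_sum n (T : eqType) (s : seq T) (P : pred T) (F : T -> R) :
  (forall i, i \in s -> P i -> gr_comp n (F i)) ->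
  gr_comp n (\sum_(i <- s | P i) F i).
Proof.
move=> HF; rewrite big_seq_cond; apply: (big_ind (@gr_comp N R n)).
- exact: gr_comp0.
- move=> x y nx ny; rewrite -[y]opprK -[- y]add0r; apply: gr_compB => //.
  by apply: gr_compB => //; exact: gr_comp0.
- by move=> i /andP[]; exact: HF.
Qed.

(** Let [f j] be the part of [l] in degree [j], minus [x] when [j = n]. These sum to 0, so
    directness makes each of them vanish, [f n] in particular. *)
Lemma homogeneous_part n x (l : seq (N * R)) : gr_comp n x ->
  (forall p, p \in l -> gr_comp p.1 p.2) -> x = \sum_(p <- l) p.2 ->
  x = \sum_(p <- l | p.1 == n) p.2.
Proof.
move=> nx Hl xE; have [_ direct] := gr_dsum R.
(* [n] is put in explicitly, since it may be absent from the degrees in [l]. *)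
pose s := undup (n :: [seq p.1 | p <- l]).
pose f j := \sum_(p <- l | p.1 == j) p.2 - (if j == n then x else 0).
have ns : n \in s by rewrite mem_undup mem_head.
have us : uniq s := undup_uniq _.
have fs j : j \in s -> gr_comp j (f j).
  move=> _; apply: gr_compB; first by apply: gr_comp_sum => p /Hl + /eqP <-.
  by case: eqP => [->|_] //; exact: gr_comp0.
have single j y : j \in s -> \sum_(i <- s) (if i == j then y else 0) = y.
  move=> js; rewrite (bigD1_seq j) //= eqxx big1_seq ?addr0 // => i /andP[+ _].
  by move/negPf ->.
have f0 : \sum_(j <- s) f j = 0.
  rewrite sumrB single // [in X in _ - X]xE.
  apply/eqP; rewrite subr_eq0; apply/eqP.
  under eq_bigr => j _ do rewrite big_mkcond.
  rewrite exchange_big /= big_seq [RHS]big_seq; apply: eq_bigr => p pl.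
  under eq_bigr => j _ do rewrite eq_sym.
  by rewrite single // mem_undup inE map_f ?orbT.
have := direct s f us fs f0 n ns.
by rewrite /f eqxx => /eqP; rewrite subr_eq0 => /eqP ->.
Qed.

Definition ideal_add I J : set R := ideal_sum [set A | A = I \/ A = J].

Lemma graded_ideal_add I J : graded_ideal I -> graded_ideal J ->
  graded_ideal (ideal_add I J).
Proof. by move=> gI gJ; apply: graded_ideal_sum => A [->|->]. Qed.

Lemma ideal_add_subl I J : I `<=` ideal_add I J.
Proof. by apply: ideal_sum_sup; left. Qed.

Lemma ideal_add_subr I J : J `<=` ideal_add I J.
Proof. by apply: ideal_sum_sup; right. Qed.

Lemma ideal_add_mulr I J M x y : ring_ideal M ->
  (forall z, I z -> M (x ** z)) -> (forall z, J z -> M (x ** z)) ->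
  ideal_add I J y -> M (x ** y).
Proof.
move=> idM HI HJ [l Hl ->].
rewrite (big_morph (gr_mul x) (gr_mulDr x) (gr_mulx0 x)).
by apply: ring_ideal_sum => // i /Hl [A [->|->]]; [exact: HI|exact: HJ].
Qed.

Lemma ideal_add_mull I J M x y : ring_ideal M ->
  (forall z, I z -> M (z ** x)) -> (forall z, J z -> M (z ** x)) ->
  ideal_add I J y -> M (y ** x).
Proof.
move=> idM HI HJ [l Hl ->].
rewrite (big_morph (fun y => y ** x) (fun a b => gr_mulDl a b x) (gr_mul0x x)).
by apply: ring_ideal_sum => // i /Hl [A [->|->]]; [exact: HI|exact: HJ].
Qed.

Lemma ideal_add_span I J x : graded_ideal I -> graded_ideal J ->
  ideal_add I J x -> exists2 l : seq (N * R),
    (forall p, p \in l -> (I p.2 \/ J p.2) /\ gr_comp p.1 p.2) &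
    x = \sum_(p <- l) p.2.
Proof.
move=> gI gJ [l Hl ->] {x}; elim: l Hl => [|y l IHl] Hl.
  by exists [::]; rewrite ?big_nil.
have [|l' Hl' lE] := IHl; first by move=> z zl; apply: Hl; rewrite inE zl orbT.
have [A HA Ay] := Hl _ (mem_head _ _).
have gA : graded_ideal A by case: HA => ->.
have [la Hla yE] := graded_ideal_span gA Ay.
exists (la ++ l'); last by rewrite big_cons big_cat lE yE.
move=> p; rewrite mem_cat => /orP[/Hla[Ap hp]|/Hl' //].
by split=> //; case: HA => <-; [left|right].
Qed.

Lemma graded_ideal_bigcup (C : set (set R)) : C !=set0 ->
  total_on C subset -> C `<=` @graded_ideal N R ->
  graded_ideal (\bigcup_(A in C) A).
Proof.
move=> [A0 CA0] totC Cgr; apply: graded_idealP; last first.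
  move=> x [A CA Ax]; have [l Hl ->] := graded_ideal_span (Cgr _ CA) Ax.
  exists [seq p.2 | p <- l]; last by rewrite big_map.
  by move=> y /mapP[p /Hl[Ap hp] ->]; exists p.1 => //; exists A.
split.
- by exists A0 => //; have [[]] := Cgr _ CA0.
- move=> x y [A CA Ax] [B CB By].
  have [AB|BA] := totC _ _ CA CB.
    exists B => //; have [[_ BB _ _] _] := Cgr _ CB.
    by apply: BB => //; exact: AB.
  exists A => //; have [[_ AB _ _] _] := Cgr _ CA.
  by apply: AB => //; exact: BA.
- move=> a x [A CA Ax]; exists A => //.
  by have [[_ _ Al _] _] := Cgr _ CA; exact: Al.
- move=> a x [A CA Ax]; exists A => //.
  by have [[_ _ _ Ar] _] := Cgr _ CA; exact: Ar.
Qed.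

(* A graded ideal which is maximal among those avoiding an idempotent is prime:
   if M + I and M + J contain e, then e = e e lies in M + I J. *)
Lemma exists_prime_avoiding I e : graded_ideal I -> e ** e = e -> ~ I e ->
  exists P : grSpec R, I `<=` P /\ ~ gr_ideal P e.
Proof.
move=> gI ee nIe.
(* [Zorn_bigcup] also asks for the union of the empty chain, which is empty; joining [I] to each
   candidate turns it into [I] itself. *)
have [|A [[gA nAe] maxA]] :=
  @Zorn_bigcup R [set A | graded_ideal (I `|` A) /\ ~ (I `|` A) e].
  move=> F FP totF; pose C : set (set R) := I |` [set I `|` A | A in F].
  have CE : I `|` \bigcup_(A in F) A = \bigcup_(A in C) A.
    apply/seteqP; split=> x.
      case=> [Ix|[A FA Ax]]; first by exists I => //; left.
      by exists (I `|` A); [right; exists A|right].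
    case=> B [->|[A FA <-]]; first by left.
    by case=> [Ix|Ax]; [left|right; exists A].
  suff : graded_ideal (\bigcup_(A in C) A) /\ ~ (\bigcup_(A in C) A) e.
    by rewrite -CE.
  split; last first.
    by move=> [B [->|[A FA <-]]]; [exact: nIe|have [_] := FP _ FA].
  apply: graded_ideal_bigcup; first by exists I; left.
    move=> B B' [->|[A FA <-]] [->|[A' FA' <-]].
    - by left.
    - by left => x; left.
    - by right => x; left.
    - by case: (totF _ _ FA FA') => H; [left|right]; exact: setUS.
  by move=> B [-> //|[A FA <-]]; have [] := FP _ FA.
set M := I `|` A in gA nAe.
have IM : I `<=` M by move=> x; left.
have [idM _] := gA; have [_ _ Ml Mr] := idM.
(* The sum of [M] and [J] contains [I], so if it avoided [e] it would be a candidate, strictly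
   larger than [A] as [J] is not inside [M]. *)
have maxM J : graded_ideal J -> ~ J `<=` M -> ideal_add M J e.
  move=> gJ nJM; apply: contrapT => ne; apply: (maxA (ideal_add M J)).
    split; first by move=> x Ax; apply: ideal_add_subl; right.
    move=> H; apply: nJM => x Jx; right; apply: H; exact: ideal_add_subr.
  have MJ : I `|` ideal_add M J = ideal_add M J.
    by apply/setUidPr => x /IM; exact: ideal_add_subl.
  suff : graded_ideal (ideal_add M J) /\ ~ ideal_add M J e by rewrite -{1 2}MJ.
  by split=> //; exact: graded_ideal_add.
suff pM : graded_prime M by exists (GrSpec pM).
split=> //; first by move=> MT; apply: nAe; rewrite MT.
move=> J J' gJ gJ' JJ'; apply: contrapT => /not_orP[nJ nJ']; apply: nAe.
rewrite -/M -ee; apply: (ideal_add_mulr (I := M) (J := J')) => //.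
- by move=> z Mz; exact: Ml.
- move=> z J'z; apply: (ideal_add_mull (I := M) (J := J)) => //.
  + by move=> y My; exact: Mr.
  + by move=> y Jy; apply: JJ'; exact: ideal_mulE.
  + exact: maxM.
- exact: maxM.
Qed.

End GradedRing.

(** * Graded ideals of KP(L) and their vertex sets *)

Section KPIdeals.
Local Open Scope classical_set_scope.
Local Open Scope ring_scope.
Variables (K : fieldType) (k : nat) (L : kgraph k).
Hypothesis L_rf : row_finite L.
Implicit Types (v : vert L) (H : set (vert L)) (I J : set (KP K L)).
Implicit Types (x y : KPalg K L).
Local Notation "x ** y" := (KP_mul x y) (at level 40, left associativity).

Definition vert_of I : set (vert L) := [set v | I (KPvert K v)].

(** Heredity comes from p_{s(a)} = s_a^* p_v s_a, saturation from p_v being the sum of the s_a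
    p_{s(a)} s_a^*. *)
Lemma hereditary_saturated_vert_of I :
  ring_ideal I -> hereditary_saturated (vert_of I).
Proof.
move=> idI v m; have [_ _ Il Ir] := idI; split.
  move=> Iv a [_ av]; rewrite /vert_of /=.
  have := KPghost_path K (erefl (deg a)); rewrite eqxx => <-.
  by rewrite -(KPvert_path K a) av; apply: (Il); exact: (Ir).
have [s sP Iv] := KPvert_sum K L_rf v m.
move=> HI; rewrite /vert_of /= Iv.
apply: (ring_ideal_sum (I := I)) => // a /sP va.
by rewrite -(KPpath_vert K a); apply: (Ir); apply: (Il); exact: HI.
Qed.

Lemma vert_of_setT I : ring_ideal I -> vert_of I = setT -> I = setT.
Proof.
move=> idI IT; have Iv v : I (KPvert K v) by rewrite -[I _]/(vert_of I v) IT.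
have [I0 _ Il Ir] := idI.
(* [ring_ideal] does not include stability under scalars, so the scalar is carried through the
   induction. *)
suff : forall x (c : K), I (c *: x).
  by move=> H; apply/seteqP; split=> // x _; rewrite -[x]scale1r; exact: H.
apply: (KP_ind L_rf) => [c|x y Hx Hy c|d x Hx c|a b ab c].
- by rewrite scaler0.
- by rewrite scalerDr; apply: (@ring_idealD _ (KP K L)).
- by rewrite scalerA.
- rewrite KP_scaleAl -(KPpath_vert K a) KP_scaleAl.
  by apply: (Ir); exact: Il (Iv _).
Qed.

Lemma grSpec_vert (P : grSpec (KP K L)) : vert_of P <> setT.
Proof.
by have [[idP _] nP _] := gr_idealP P => /(vert_of_setT idP).
Qed.

(** This is the ideal generated by the p_v with [v] in [H]; it contains p_v in the form p_v p_v
    p_v. *)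
Inductive KPideal H : set (KP K L) :=
| KPideal0 : KPideal H 0
| KPidealD x y : KPideal H x -> KPideal H y -> KPideal H (x + y)
| KPideal_gen x v y : H v -> KPideal H (x ** KPvert K v ** y).

Lemma ring_ideal_KPideal H : ring_ideal (KPideal H).
Proof.
split.
- exact: KPideal0.
- move=> x y Hx Hy; apply: KPidealD => //.
  elim: Hy => [|y1 y2 _ IH1 _ IH2|a v b Hv].
  + by rewrite oppr0; exact: KPideal0.
  + by rewrite opprD; exact: KPidealD.
  + by rewrite -scaleN1r !KP_scaleAl; exact: KPideal_gen.
- move=> a x; elim=> [|x1 x2 _ IH1 _ IH2|b v c Hv].
  + by rewrite gr_mulx0; exact: KPideal0.
  + by rewrite gr_mulDr; exact: KPidealD.
  + by rewrite !gr_mulA; exact: KPideal_gen.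
- move=> a x; elim=> [|x1 x2 _ IH1 _ IH2|b v c Hv].
  + by rewrite gr_mul0x; exact: KPideal0.
  + by rewrite gr_mulDl; exact: KPidealD.
  + by rewrite -gr_mulA; exact: KPideal_gen.
Qed.

Lemma graded_KPideal H : graded_ideal (KPideal H).
Proof.
apply: graded_idealP; first exact: ring_ideal_KPideal.
move=> x; elim=> [|x1 x2 _ [l Hl ->] _ [l' Hl' ->]|a v b Hv].
- by exists [::]; rewrite ?big_nil.
- exists (l ++ l'); last by rewrite big_cat.
  by move=> y; rewrite mem_cat => /orP[/Hl|/Hl'].
have [la Hla ->] := graded_ideal_span (graded_idealT (KP K L)) (I : setT a).
have [lb Hlb ->] := graded_ideal_span (graded_idealT (KP K L)) (I : setT b).
exists [seq p.2 ** KPvert K v ** q.2 | p <- la, q <- lb].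
  move=> y /allpairsP[[p q] /= [/Hla[_ hp] /Hlb[_ hq] ->]].
  exists (p.1 + 0 + q.1); first exact: KPideal_gen.
  apply: KP_comp_mul => //; apply: KP_comp_mul => //.
  exact: (KP_comp_gen K (KPp v)).
rewrite big_allpairs_dep !KP_mul_suml; apply: eq_bigr => p _.
by rewrite KP_mul_sumr.
Qed.

Lemma vert_of_KPideal H : H `<=` vert_of (KPideal H).
Proof.
move=> v Hv; rewrite /vert_of /= -(KPvert_idem K v).
rewrite -[X in X ** _](KPvert_idem K v).
exact: KPideal_gen.
Qed.

(** If p_v s_a s_b^* p_w is nonzero, then [a] has range [v] and [b] has range [w], and heredity puts
    the common source of [a] and [b] in both sets. *)
Lemma KPideal_mul0 H H' x y :
  hereditary_saturated H -> hereditary_saturated H' ->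
  H `&` H' = set0 -> KPideal H x -> KPideal H' y -> x ** y = 0.
Proof.
move=> hsH hsH' HH'.
have vw0 v w z : H v -> H' w -> KPvert K v ** z ** KPvert K w = 0.
  move=> Hv Hw; move: z.
  apply: (KP_ind L_rf) => [|z z' Hz Hz'|c z Hz|a b ab].
  - by rewrite KP_mulx0 KP_mul0x.
  - by rewrite KP_mulDr KP_mulDl Hz Hz' addr0.
  - by rewrite -KP_scaleAr -KP_scaleAl Hz scaler0.
  rewrite KP_mulA -(KPvert_path K a) KP_mulA KPvertM.
  case: eqP => [va|_]; last by rewrite !KP_mul0x.
  rewrite -[LHS]KP_mulA -(KPghost_vert K b) -[KPghost K b ** _ ** _]KP_mulA.
  rewrite KPvertM.
  case: eqP => [bw|_]; last by rewrite !KP_mulx0.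
  have : (H `&` H') (src a).
    split; first by have /hsH := Hv; apply; split; last exact: esym.
    by rewrite ab; have /hsH' := Hw; apply; split; last exact: bw.
  by rewrite HH'.
elim=> [|x1 x2 _ IH1 _ IH2|a v b Hv] Hy.
- exact: KP_mul0x.
- by rewrite KP_mulDl IH1 // IH2 // addr0.
elim: Hy => [|y1 y2 _ IH1 _ IH2|c w d Hw].
- exact: KP_mulx0.
- by rewrite KP_mulDr IH1 IH2 addr0.
rewrite -[X in X ** _]KP_mulA -[X in _ ** X]KP_mulA -KP_mulA.
rewrite [KPvert K v ** b ** _]KP_mulA [_ ** (KPvert K w ** d)]KP_mulA.
rewrite -[KPvert K v ** b ** c]KP_mulA vw0 //.
by rewrite KP_mul0x KP_mulx0.
Qed.

Hypothesis L_ns : no_sources L.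

Lemma exists_prime_avoiding_vert I v : graded_ideal I -> ~ vert_of I v ->
  exists P : grSpec (KP K L), I `<=` P /\ ~ vert_of P v.
Proof.
by move=> gI; apply: exists_prime_avoiding => //; exact: KPvert_idem.
Qed.

(* The degree 0 components of the summands of p_v lie in a common
   [KPspan m m], so that compressing them by s_a, for a in vL^m, exhibits
   p_(s(a)) as a sum of one multiple of itself in I and one in J. *)
Lemma vert_of_add I J v : graded_ideal I -> graded_ideal J ->
  vert_of (ideal_add I J) v ->
  exists m, forall a, paths v m a -> vert_of I (src a) \/ vert_of J (src a).
Proof.
move=> gI gJ Iv.
have [idI _] := gI; have [idJ _] := gJ.
have [I0 _ Il Ir] := idI; have [J0 _ Jl Jr] := idJ.
have [l Hl vE] := ideal_add_span gI gJ Iv.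
pose Q x := exists m x1 x2,
  [/\ I x1, J x2, KPspan m m x1, KPspan m m x2 & x = x1 + x2].
suff [m [x1 [x2 [I1 J2 span1 span2 vE']]]] : Q (KPvert K v).
  exists m => a [am av].
  have [c Ec] := KPspan_coef span1 am am.
  have [d Ed] := KPspan_coef span2 am am.
  have E : KPvert K (src a) = c *: KPvert K (src a) + d *: KPvert K (src a).
    rewrite -Ec -Ed -KP_mulDl -KP_mulDr -vE' -av KPghost_vert KPghost_path //.
    by rewrite eqxx.
  (* Division by [e] is a multiplication by e^-1 p_w, an element of the ring. *)
  have scale_mem (A : set (KP K L)) (e : K) w : ring_ideal A -> e != 0 ->
      A (e *: KPvert K w) -> A (KPvert K w).
    move=> [_ _ Al _] e0 Aw; rewrite -(KPvert_idem K w).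
    rewrite -[_ ** _]scale1r -(mulVf e0) -scalerA KP_scaleAr KP_scaleAl.
    exact: (Al (e^-1 *: KPvert K w)).
  have Ic : I (c *: KPvert K (src a)) by rewrite -Ec; apply: (Ir); exact: Il.
  have Jd : J (d *: KPvert K (src a)) by rewrite -Ed; apply: (Jr); exact: Jl.
  have [c0|c0] := eqVneq c 0; last by left; exact: scale_mem Ic.
  have [d0|d0] := eqVneq d 0; last by right; exact: scale_mem Jd.
  by move: E; rewrite c0 d0 !scale0r addr0 => /(KP_vertex_neq0 L_rf L_ns).
have v0 : gr_comp (0 : 'rV[int]_k) (KPvert K v : KP K L).
  exact: (KP_comp_gen K (KPp v)).
have -> : KPvert K v = \sum_(p <- l | p.1 == 0) p.2.
  by apply: (@homogeneous_part _ (KP K L)) => //; move=> p /Hl[].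
rewrite big_seq_cond; apply: (big_ind Q).
- by exists 0, 0, 0; split; rewrite ?addr0 //; exact: KPspan0.
- move=> x y [m [x1 [x2 [Ix Jx Fx1 Fx2 ->]]]] [n [y1 [y2 [Iy Jy Fy1 Fy2 ->]]]].
  exists (m + n), (x1 + y1), (x2 + y2); split; last exact: addrACA.
  + by apply: (@ring_idealD _ (KP K L)).
  + by apply: (@ring_idealD _ (KP K L)).
  + apply: KPspanD; first exact: KPspan_raise.
    by rewrite addrC; exact: KPspan_raise.
  + apply: KPspanD; first exact: KPspan_raise.
    by rewrite addrC; exact: KPspan_raise.
- move=> p /andP[/Hl[IJp hp] /eqP p0].
  have [m [n [mn span]]] := KP_compP L_rf hp.
  have {span} span : KPspan (m + n) (m + n) p.2.
    move: mn; rewrite p0 => /eqP; rewrite subr_eq0 => /eqP mn.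
    have {}mn : m = n.
      by apply/rowP => i; have /rowP/(_ i) := mn; rewrite !mxE => -[].
    by rewrite {2}mn in span *; rewrite -mn in span *; exact: KPspan_raise.
  by case: IJp => Hp; [exists (m + n), p.2, 0|exists (m + n), 0, p.2];
    split; rewrite ?addr0 ?add0r //; exact: KPspan0.
Qed.

(** * Connectedness against indecomposability *)

Lemma connected_indecomposable :
  connected [set: grSpec (KP K L)] -> indecomposable L.
Proof.
move=> conn; suff : ~ decomposable L by [].
move=> /(decomposable_vertP L_rf L_ns)[H1 [H2 [[hs1 n1] [hs2 n2] H12 gen]]].
(* The two ideals have product 0, which every prime contains. *)
have VE (P : grSpec (KP K L)) : KPideal H1 `<=` P \/ KPideal H2 `<=` P.
  have [[[P0 _ _ _] _] _ prP] := gr_idealP P.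
  apply: prP; [exact: graded_KPideal|exact: graded_KPideal|].
  move=> x [l Hl ->]; rewrite big_seq big1 // => p /Hl[p1 p2].
  exact: KPideal_mul0 hs1 hs2 H12 p1 p2.
(* The vertex set of a prime containing both ideals is saturated and contains [H1] and [H2]; it
   would be everything. *)
have VI (P : grSpec (KP K L)) : KPideal H1 `<=` P -> KPideal H2 `<=` P -> False.
  move=> P1 P2; have [[idP _] _ _] := gr_idealP P.
  apply: (@grSpec_vert P); apply: gen.
  - exact: hereditary_saturated_vert_of.
  - by move=> v /vert_of_KPideal; exact: P1.
  - by move=> v /vert_of_KPideal; exact: P2.
(* If no prime contains the ideal of [H], that ideal contains every p_v; for [v] in [H'] the
   idempotent p_v = p_v p_v would then be a zero product. *)
have empty H H' : hereditary_saturated H -> hereditary_saturated H' ->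
    H `&` H' = set0 -> Vgr (KPideal H) = set0 -> H' = set0.
  move=> hsH hsH' HH' V0; apply/seteqP; split=> // v H'v.
  have Hv : vert_of (KPideal H) v.
    apply: contrapT => /(exists_prime_avoiding_vert (graded_KPideal H)).
    by case=> P [HP _]; have : Vgr (KPideal H) P by []; rewrite V0.
  apply: (@KP_vertex_neq0 K k L L_rf L_ns v).
  rewrite -[LHS](KPvert_idem K v).
  exact: KPideal_mul0 hsH hsH' HH' Hv (vert_of_KPideal H'v).
have V12 : Vgr (KPideal H1) = ~` Vgr (KPideal H2) :> set (grSpec (KP K L)).
  apply/seteqP; split=> P /=; first by move=> P1 P2; exact: VI P1 P2.
  by case: (VE P).
(* If the closed set of [H1] is empty, so is [H2], and then [H1] alone generates all vertices
   although it is proper. *)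
have [V1|/set0P V1] := eqVneq (Vgr (KPideal H1) : set (grSpec (KP K L))) set0.
  have E := empty _ _ hs1 hs2 H12 V1.
  by apply: n1; apply: gen => //; rewrite E.
have VT : Vgr (KPideal H1) = setT :> set (grSpec (KP K L)).
  apply: conn => //.
    exists (Vgr (KPideal H1)); last by rewrite setTI.
    by rewrite V12; exists (KPideal H2); first exact: graded_KPideal.
  exists (Vgr (KPideal H1)); last by rewrite setTI.
  by apply/closed_grSpecP; exists (KPideal H1); first exact: graded_KPideal.
have V2 : Vgr (KPideal H2) = set0 :> set (grSpec (KP K L)).
  by rewrite -[LHS]setCK -V12 VT setCT.
rewrite setIC in H12; have E := empty _ _ hs2 hs1 H12 V2.
by apply: n2; apply: gen => //; rewrite E.
Qed.

Lemma indecomposable_connected :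
  indecomposable L -> connected [set: grSpec (KP K L)].
Proof.
move=> indec B [P0 BP0] [C oC BC] [D cD BD].
rewrite setTI in BC; rewrite setTI in BD; subst C; subst D.
apply: contrapT => BT; apply: indec; apply/decomposable_vertP => //.
(* [B] is both the closed set of [I] and the complement of that of [J], so every graded prime
   contains exactly one of [I] and [J]. *)
have /closed_grSpecP[I gI BI] := cD.
have [J gJ BJ] := oC.
have [idI _] := gI; have [idJ _] := gJ.
exists (vert_of I), (vert_of J); split.
- split; first exact: hereditary_saturated_vert_of.
  move=> IT; apply: (@grSpec_vert P0); apply/seteqP; split=> // v _.
  by have : vert_of I v; [rewrite IT|move: BP0; rewrite BI; apply].
- split; first exact: hereditary_saturated_vert_of.
  move=> JT; apply: BT; rewrite BJ; apply/seteqP; split=> // P _ /= JP.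
  apply: (@grSpec_vert P); apply/seteqP; split=> // v _.
  by apply: JP; rewrite -[J _]/(vert_of J v) JT.
(* A common vertex would have its idempotent in every graded prime, but some prime above 0 avoids
   the nonzero p_v. *)
- apply/seteqP; split=> // v [Iv Jv].
  have [|P [_ nPv]] := @exists_prime_avoiding_vert [set 0] v (graded_ideal0 _).
    exact: KP_vertex_neq0.
  apply: nPv; have [BP|] := pselect (B P).
    by move: BP; rewrite BI; apply.
  by rewrite BJ => /contrapT; apply.
(* No graded prime contains both ideals, so their sum contains every p_v; then the sources of the
   paths in vL^m lie in [H], and saturation gives [v]. *)
- move=> H hsH HI HJ; apply/seteqP; split=> // v _.
  have [|m Hm] := @vert_of_add I J v gI gJ.
    apply: contrapT => nv.
    have [P [IJP _]] := exists_prime_avoiding_vert (graded_ideal_add gI gJ) nv.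
    have : B P by rewrite BI => x /(ideal_add_subl J) /IJP.
    by rewrite BJ; apply => x /(ideal_add_subr I) /IJP.
  by apply/(hsH v m) => a /Hm[/HI|/HJ].
Qed.

End KPIdeals.

Theorem corollary5p9 (k : nat) (k_ge1 : (1 <= k)%N) (K : fieldType)
  (L : kgraph k) (L_rf : row_finite L) (L_ns : no_sources L) :
  connected [set: grSpec (KP K L)]%classic <-> indecomposable L.
Proof.
by split; [exact: connected_indecomposable|exact: indecomposable_connected].
Qed.
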